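(* Let $C:f=0$ be a reduced curve of degree $d\geq 3$ in $\mathbb{P}^2$. Then $C$ is a 3-syzygy curve if and only if the Bourbaki ideal $B(C,r_1)$, for some nonzero syzygy $r_1\in AR(f)$ of minimal degree, is a complete intersection. More precisely, with $r_1\in AR(f)$ a nonzero syzygy of minimal degree and $r_2,r_3\in AR(f)$ homogeneous, $r_1,r_2,r_3$ form a minimal system of generators for $AR(f)$ if and only if $g_2=v(r_2)$ and $g_3=v(r_3)$ generate the ideal $B(C,r_1)$.
   Context: Let $S=\mathbb{C}[x,y,z]$ with its standard grading, $f\in S$ homogeneous of degree $d$. Put $AR(f)=\{(a,b,c)\in S^3: af_x+bf_y+cf_z=0\}$, a graded $S$-module in which $(a,b,c)$ has degree $k$ when $a,b,c\in S_k$. The curve $C$ is an $m$-syzygy curve if a minimal set of homogeneous generators of $AR(f)$ has $m$ elements. Let $r_1=(a_1,b_1,c_1)\in AR(f)$ be a nonzero homogeneous syzygy of minimal degree $d_1$. For a homogeneous $r=(a,b,c)\in AR(f)$ let $\Delta(r)$ be the determinant of the $3\times 3$ matrix with rows $(x,y,z)$, $(a_1,b_1,c_1)$, $(a,b,c)$. It is known that $f$ divides $\Delta(r)$, and one defines the morphism of graded $S$-modules $v:AR(f)\to S(d_1-d+1)$, $v(r)=\Delta(r)/f$. The Bourbaki ideal $B(C,r_1)\subset S$ is the homogeneous ideal with $\operatorname{im} v=B(C,r_1)(d_1-d+1)$. ''Complete intersection'' means here a proper homogeneous ideal of codimension 2 generated by two homogeneous elements.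
   Formalization: In the last equivalence, ''g2 and g3 generate B(C,r1)'' is supplemented by the condition that B(C,r1) is a proper ideal; without it the claim fails for free curves, e.g. f=xyz, r1=(x,-y,0), r2=(0,y,-z), r3=0. *)

(* Defs.v *)
From HB Require Import structures.
From mathcomp Require Import all_boot all_order all_algebra.
From mathcomp Require Import boolp classical_sets reals complex.
From mathcomp Require Import mpoly.

Set Implicit Arguments.
Unset Strict Implicit.
Unset Printing Implicit Defensive.

Import GRing.Theory.
Local Open Scope classical_set_scope.
Local Open Scope ring_scope.

Section Codimension.
Variable A : comNzRingType.

(* [idealr_closed] already requires properness. *)
Definition prime_ideal (P : set A) : Prop :=
  idealr_closed (mem P) /\ prime_idealr_closed (mem P).

(* A strict chain Q 0 < ... < Q n = P of prime ideals: P has height >= n. *)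
Definition prime_chain (P : set A) (n : nat) : Prop :=
  exists Q : nat -> set A,
    [/\ forall i, (i <= n)%N -> prime_ideal (Q i),
        forall i, (i < n)%N -> Q i `<` Q i.+1
      & Q n = P].

Definition height (P : set A) (n : nat) : Prop :=
  prime_chain P n /\ ~ prime_chain P n.+1.

(* n is the minimum of the heights of the prime ideals containing I. *)
Definition codim (I : set A) (n : nat) : Prop :=
  (exists P, [/\ prime_ideal P, I `<=` P & height P n]) /\
  (forall P, prime_ideal P -> I `<=` P -> prime_chain P n).

Definition ideal_gen2 (g h : A) : set A :=
  [set p | exists u v : A, p = u * g + v * h].

End Codimension.

Section Syzygies.
Variable R : realType.

(* R[i] is the field of complex numbers; 'X_0, 'X_1, 'X_2 are x, y, z. *)
Local Notation S := {mpoly R[i][3]}.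
Local Notation S3 := 'rV[{mpoly R[i][3]}]_3.

(* A form defines a reduced curve when it has no repeated factor. *)
Definition squarefree (f : S) : Prop :=
  f != 0 /\ forall g h : S, f = g ^+ 2 * h -> g \is a GRing.unit.

Definition homogeneous (g : S) : Prop := exists k : nat, g \is k.-homog.

Definition syz_homog_deg (k : nat) (r : S3) : Prop :=
  forall i : 'I_3, r 0 i \is k.-homog.

Definition syz_homogeneous (r : S3) : Prop := exists k, syz_homog_deg k r.

Definition AR (f : S) : set S3 :=
  [set r | \sum_(i < 3) r 0 i * f^`M(i) = 0].

Definition span (rs : seq S3) : set S3 :=
  [set r | exists c : nat -> S, r = \sum_(i < size rs) c i *: rs`_i].

Definition minimal_generators (f : S) (rs : seq S3) : Prop :=
  [/\ forall r, r \in rs -> syz_homogeneous r,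
      AR f = span rs
    & forall t, subseq t rs -> AR f = span t -> t = rs].

Definition syzygy_curve (m : nat) (f : S) : Prop :=
  exists rs : seq S3, size rs = m /\ minimal_generators f rs.

Definition minimal_degree_syzygy (f : S) (r1 : S3) : Prop :=
  exists d1 : nat,
    [/\ AR f r1, r1 != 0, syz_homog_deg d1 r1
      & forall k r, AR f r -> r != 0 -> syz_homog_deg k r -> (d1 <= k)%N].

Definition Delta (r1 r : S3) : S :=
  \det (\matrix_(i < 3) tnth [tuple \row_(j < 3) 'X_j; r1; r] i).

(* The quotient Delta r1 r / f. The default value 0 of [xget] is irrelevant:
   for f squarefree and r1, r in AR f, f divides Delta r1 r, and the quotient
   is unique since f != 0. *)
Definition v (f : S) (r1 r : S3) : S := xget 0 [set g | g * f = Delta r1 r].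

(* The degree shift of the graded morphism v does not affect the underlying
   set of its image. *)
Definition Bourbaki (f : S) (r1 : S3) : set S := v f r1 @` AR f.

(* An ideal generated by homogeneous elements is homogeneous. *)
Definition complete_intersection (I : set S) : Prop :=
  [/\ ~ I 1, codim I 2
    & exists g h : S, [/\ homogeneous g, homogeneous h & I = ideal_gen2 g h]].

End Syzygies.

(* Main.v *)
(* The map v has kernel S r_1 and image B, so r_2, r_3 generate
   AR(f) together with r_1 exactly when v(r_2), v(r_3) generate B. Dividing by
   f is possible because Delta(r) f_i = d f c_i, where c = r_1 x r, so that f
   divides every Delta(r) f_i, and a prime factor of the squarefree f does not
   divide all of its own derivatives. Similarly v(r) = 0 forces r_1 x r = 0, and
   the entries of r_1 have no common factor by minimality of its degree.

   Applied to the Koszul syzygies e_i x grad f, v takes the value -d r_1i; hence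
   B contains the entries of r_1 and lies in no proper principal ideal. This is
   what makes the generators minimal when B is proper, and it gives height at
   least 2 for every prime P containing B: P contains a prime element p, and
   0 < (p) < P.

   Conversely two forms generating a proper ideal lie in a prime of height at
   most 2. If powers of x, y and z all lay in (g, h), S would be a finite module
   over C[g, h], contradicting dimension counts; so the powers of some variable
   t avoid (g, h), and by Zorn's lemma there is a prime P above (g, h) modulo
   which t is transcendental. A chain of length 3 below P would give four
   algebraically independent elements of S. *)

Require Import Defs.
From HB Require Import structures.
From mathcomp Require Import all_boot all_order all_algebra.
From mathcomp Require Import boolp classical_sets reals complex.
From mathcomp Require Import mpoly.
From mathcomp Require Import ring zify.
Import Defs.

Set Implicit Arguments.
Unset Strict Implicit.
Unset Printing Implicit Defensive.

Import Order.TTheory GRing.Theory Num.Theory.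
Local Open Scope classical_set_scope.
Local Open Scope ring_scope.

(** * Factorial domains *)

Definition divides (A : comNzRingType) (a b : A) : Prop := exists c, b = c * a.

Section Divides.
Variable A : comNzRingType.
Implicit Types a b c : A.

Lemma divides_refl a : divides a a.
Proof. by exists 1; rewrite mul1r. Qed.

Lemma divides0 a : divides a 0.
Proof. by exists 0; rewrite mul0r. Qed.

Lemma divides_mull a b c : divides a b -> divides a (c * b).
Proof. by case=> e ->; exists (c * e); rewrite mulrA. Qed.

Lemma divides_mulr a b c : divides a b -> divides a (b * c).
Proof. by rewrite mulrC; exact: divides_mull. Qed.

Lemma dividesD a b c : divides a b -> divides a c -> divides a (b + c).
Proof. by case=> e -> [e' ->]; exists (e + e'); rewrite mulrDl. Qed.

Lemma dividesN a b : divides a b -> divides a (- b).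
Proof. by case=> e ->; exists (- e); rewrite mulNr. Qed.

Lemma dividesB a b c : divides a b -> divides a c -> divides a (b - c).
Proof. by move=> ab ac; apply: dividesD => //; apply: dividesN. Qed.

Lemma divides_sum a (I : Type) (s : seq I) (P : pred I) (F : I -> A) :
  (forall i, P i -> divides a (F i)) -> divides a (\sum_(i <- s | P i) F i).
Proof.
move=> aF; elim/big_ind: _ => //; first exact: divides0.
by move=> b c; exact: dividesD.
Qed.

End Divides.

Definition prime_elt (A : idomainType) (p : A) : Prop :=
  [/\ p != 0, p \isn't a GRing.unit
    & forall a b, divides p (a * b) -> divides p a \/ divides p b].

(** The factors are prime, not just irreducible, so uniqueness of factorization is built in. The
    index counts them and serves as an induction measure. *)
Inductive prime_product (A : idomainType) : nat -> A -> Prop :=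
| PrimeProductUnit u : u \is a GRing.unit -> prime_product 0 u
| PrimeProductMul n p a :
    prime_elt p -> prime_product n a -> prime_product n.+1 (p * a).

Definition factorial_domain (A : idomainType) : Prop :=
  forall a : A, a != 0 -> exists n, prime_product n a.

Section PrimeProduct.
Variable A : idomainType.
Implicit Types a b p q u : A.

Lemma unit_divides1 u : divides u 1 -> u \is a GRing.unit.
Proof. by case=> e ue; apply/unitrPr; exists e; rewrite mulrC. Qed.

Lemma divides_unit u a : u \is a GRing.unit -> divides a u ->
  a \is a GRing.unit.
Proof. by move=> uU [c uE]; move: uU; rewrite uE unitrM => /andP[]. Qed.

Lemma prime_product_unit_mul n u a : u \is a GRing.unit ->
  prime_product n a -> prime_product n (u * a).
Proof.
move=> uU pa; elim: pa u uU => [v vU u uU|m p b pP _ IH u uU].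
  by apply: PrimeProductUnit; rewrite unitrM uU.
by rewrite mulrCA; apply: PrimeProductMul => //; exact: IH.
Qed.

Lemma prime_product_mul m n a b : prime_product m a -> prime_product n b ->
  prime_product (m + n) (a * b).
Proof.
move=> pa pb; elim: pa => [u uU|k p c pP _ IH].
  exact: prime_product_unit_mul.
by rewrite -mulrA addSn; exact: PrimeProductMul.
Qed.

Lemma prime_product1 p : prime_elt p -> prime_product 1 p.
Proof.
move=> pP; rewrite -[p]mulr1; apply: PrimeProductMul => //.
by apply: PrimeProductUnit; rewrite unitr1.
Qed.

(** Either [q] divides the leading prime, and the two are associates, or it divides the remaining
    product and induction applies. The strict decrease of the index drives the inner induction of
    [factorial_poly]. *)
Lemma prime_product_cancel n q a b : prime_elt q -> prime_product n a ->
  a = q * b -> exists2 m, (m < n)%N & prime_product m b.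
Proof.
move=> qP pa; elim: pa b => [u uU|m p c pP pc IH] b.
  move=> uE; case: qP => _ /negP[]; apply: (divides_unit uU).
  by exists b; rewrite mulrC.
case: (qP) => q0 qU qM; case: (pP) => p0 pU pM E.
have : divides q (p * c) by exists b; rewrite E mulrC.
case/qM=> [[e pE]|[c' cE]].
  have eU : e \is a GRing.unit.
    have : divides p (q * e) by exists 1; rewrite mul1r pE mulrC.
    case/pM=> [[g qE]|[g eE]].
      apply/unitrPr; exists g; apply: (mulIf p0).
      by rewrite mul1r -mulrA -qE -pE.
    case/negP: qU; apply/unitrPr; exists g; apply: (mulIf p0).
    by rewrite mul1r -mulrA -eE mulrC -pE.
  exists m => //; have -> : b = e * c.
    by apply: (mulfI q0); rewrite -E pE; ring.
  exact: prime_product_unit_mul.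
have [|k km pk] := IH c'; first by rewrite cE mulrC.
exists k.+1 => //; have -> : b = p * c'.
  by apply: (mulfI q0); rewrite -E cE; ring.
exact: PrimeProductMul.
Qed.

End PrimeProduct.

(** * Gauss's lemma and factoriality of polynomial rings *)

Section PolyDivides.
Variable D : idomainType.
Implicit Types (c p : D) (F G : {poly D}).

Lemma polyC_dividesP c F : divides c%:P F <-> forall i, divides c F`_i.
Proof.
split=> [[G ->] i|cF]; first by rewrite coefMC; exists G`_i.
have [g gE] := choice cF.
exists (\poly_(i < size F) g i); apply/polyP=> i.
rewrite coefMC coef_poly; case: ltnP => [_|Fi]; first exact: gE.
by rewrite nth_default // mul0r.
Qed.

(** If [p] divides neither [F] nor [G], take in each the lowest coefficient not divisible by [p].
    Modulo [p], the coefficient of [F * G] at the sum of the two indices is the product of these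
    two. *)
Lemma polyC_prime p : prime_elt p -> prime_elt p%:P.
Proof.
case=> p0 pU pM; split; first by rewrite polyC_eq0.
  by rewrite poly_unitE size_polyC p0 coefC.
move=> F G pFG; apply: contrapT => /not_orP[].
have minw H : ~ divides p%:P H -> exists i, ~ divides p H`_i /\
    forall j, (j < i)%N -> divides p H`_j.
  move=> /polyC_dividesP/existsNP[k pk].
  have ex : exists i, `[< ~ divides p H`_i >] by exists k; apply/asboolP.
  exists (ex_minn ex); case: ex_minnP => i /asboolP pi imin; split=> // j ji.
  by apply: contrapT => /asboolP /imin; rewrite leqNgt ji.
move=> /minw[i [pi imin]] /minw[j [pj jmin]].
have := (polyC_dividesP _ _).1 pFG (i + j)%N; rewrite coefM.
have ilt : (i < (i + j).+1)%N by rewrite ltnS leq_addr.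
rewrite (bigD1 (Ordinal ilt)) //= addKn => pS.
suff /pM[] : divides p (F`_i * G`_j) by [].
rewrite -[_ * _](addrK (\sum_(k < (i + j).+1 | k != Ordinal ilt)
  F`_k * G`_(i + j - k))).
apply: dividesB => //; apply: divides_sum => k; rewrite -val_eqE /= => ki.
have [ltki|leik] := ltnP k i; first exact/divides_mulr/imin.
by apply/divides_mull/jmin; move/eqP: ki (ltn_ord k); lia.
Qed.

Lemma prime_product_polyC n c : prime_product n c -> prime_product n c%:P.
Proof.
elim=> [u uU|m p b pP _ IH].
  have u0 : u != 0 by apply: contraTneq uU => ->; rewrite unitr0.
  by apply: PrimeProductUnit; rewrite poly_unitE size_polyC u0 coefC.
by rewrite polyCM; apply: PrimeProductMul => //; exact: polyC_prime.
Qed.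

Lemma polyZI c : c != 0 -> injective (fun F : {poly D} => c *: F).
Proof.
move=> c0 F G /eqP; rewrite -!mul_polyC -subr_eq0 -mulrBr mulf_eq0 polyC_eq0.
by rewrite (negPf c0) subr_eq0 => /eqP.
Qed.

(* Gauss's lemma: the primes of [c] can be removed one by one from a
   factorization of [c *: F]. *)
Lemma scaled_factorization n c F G H : prime_product n c -> c *: F = G * H ->
  exists G' H', [/\ F = G' * H', size G' = size G & size H' = size H].
Proof.
move=> pc; elim: pc F G H => [u uU F G H E|m p b pP _ IH F G H E].
  have u0 : u != 0 by apply: contraTneq uU => ->; rewrite unitr0.
  exists (u^-1 *: G), H; split=> //; last by rewrite size_scale ?invr_eq0.
  by rewrite -scalerAl -E scalerA mulVr // scale1r.
have p0 : p != 0 by case: pP.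
have : divides p%:P (G * H).
  by exists (b *: F); rewrite -E [RHS]mulrC mul_polyC scalerA.
have [_ _ pM] := polyC_prime pP.
case/pM=> -[K KE]; have sK : size (K * p%:P) = size K.
- by rewrite mulrC mul_polyC size_scale.
- have [|G' [H' [FE sG sH]]] := IH F K H.
    apply: (polyZI p0); rewrite /= scalerA E KE -!mul_polyC; ring.
  by exists G', H'; rewrite KE sK.
- by rewrite mulrC mul_polyC size_scale.
have [|G' [H' [FE sG sH]]] := IH F G K.
  apply: (polyZI p0); rewrite /= scalerA E KE -!mul_polyC; ring.
by exists G', H'; rewrite KE sK.
Qed.

(** A prime of [c] divides [Q * F], hence [Q] because [F] is primitive, and can be cancelled from
    both sides until only a unit is left of [c]. *)
Lemma primitive_divides n c F G Q : prime_product n c ->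
    (forall p, prime_elt p -> ~ divides p%:P F) -> c *: G = Q * F ->
  divides F G.
Proof.
move=> pc Fp; elim: pc G Q => [u uU G Q E|m p b pP _ IH G Q E].
  by exists (u^-1 *: Q); rewrite -scalerAl -E scalerA mulVr // scale1r.
have p0 : p != 0 by case: pP.
have : divides p%:P (Q * F).
  by exists (b *: G); rewrite -E [RHS]mulrC mul_polyC scalerA.
have [_ _ pM] := polyC_prime pP.
case/pM=> [[K KE]|/(Fp p pP)//]; apply: (IH G K).
by apply: (polyZI p0); rewrite /= scalerA E KE -!mul_polyC; ring.
Qed.

(** Over a domain, [%|] is divisibility up to a nonzero scalar. So [F] is handled as an irreducible
    polynomial over the fraction field, prime there by a gcd argument; [scaled_factorization] and
    [primitive_divides] clear the scalars. *)
Lemma poly_prime F : factorial_domain D -> (1 < size F)%N ->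
    (forall p, prime_elt p -> ~ divides p%:P F) ->
    (forall G H, F = G * H -> (size G < size F)%N -> (size H < size F)%N ->
       False) ->
  prime_elt F.
Proof.
move=> Df sF Fp Firr.
have F0 : F != 0 by rewrite -size_poly_gt0 ltnW.
split=> //; first by rewrite poly_unitE gtn_eqF.
have irrF G : size G != 1%N -> G %| F -> G %= F.
  move=> sG GF; have G0 : G != 0 by apply: contraTneq GF => ->; rewrite dvd0p.
  rewrite -(dvdp_size_eqp GF) eqn_leq dvdp_leq //=; rewrite leqNgt; apply/negP.
  move=> ltGF; have [[c H] /= c0 E] := Pdiv.WeakIdomain.dvdpP _ _ GF.
  have [n pc] := Df c c0.
  have [H' [G' [FE sH' sG']]] := scaled_factorization pc E.
  apply: (Firr _ _ FE); last by rewrite sG'.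
  have H'0 : H' != 0 by apply: contraNneq F0 => H'0; rewrite FE H'0 mul0r.
  have G'0 : G' != 0 by rewrite -size_poly_gt0 sG' size_poly_gt0.
  rewrite FE size_mul // sG'; move: sG; rewrite -size_poly_gt0 in G0 H'0 *.
  by move: G0; case: (size G) => [|[|k]] //; lia.
have dF G : F %| G -> divides F G.
  move=> /Pdiv.WeakIdomain.dvdpP[[c Q] /= c0 E]; have [n pc] := Df c c0.
  exact: primitive_divides pc Fp E.
move=> G H [Q E]; have FGH : F %| G * H.
  apply/Pdiv.WeakIdomain.dvdpP.
  by exists (1, Q); rewrite ?oner_neq0 //= scale1r.
have [cFG|ncFG] := boolP (coprimep F G).
  by right; apply: dF; rewrite -(Gauss_dvdpr _ cFG).
left; apply: dF; have := irrF (gcdp F G) ncFG (dvdp_gcdl _ _).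
by move=> /eqp_dvdl <-; exact: dvdp_gcdr.
Qed.

(** Nested induction on the size of [F] and on the number of primes in its leading coefficient.
    Removing a constant prime lowers the second, splitting into smaller factors lowers the first,
    and otherwise [poly_prime] applies. *)
Lemma factorial_poly : factorial_domain D -> factorial_domain {poly D}.
Proof.
move=> Df F; have [s] := ubnP (size F); elim: s F => // s IHs F sF F0.
have [n] := Df (lead_coef F) (etrans (congr1 negb (lead_coef_eq0 F)) F0).
have [t] := ubnP n; elim: t n F sF F0 => // t IHt n F sF F0 nt pn.
have [sF1|sF1] := leqP (size F) 1.
  have FE := size1_polyC sF1; have [|m pm] := Df F`_0.
    by rewrite -polyC_eq0 -FE.
  by exists m; rewrite FE; exact: prime_product_polyC.
have [[p [pP [G GE]]]|Fp] := pselect (exists p, prime_elt p /\ divides p%:P F).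
  have p0 : p != 0 by case: pP.
  have lE : lead_coef F = p * lead_coef G.
    by rewrite GE lead_coefM lead_coefC mulrC.
  have [m mn pm] := prime_product_cancel pP pn lE.
  have G0 : G != 0 by apply: contraNneq F0 => G0; rewrite GE G0 mul0r.
  have sG : size G = size F by rewrite GE mulrC mul_polyC size_scale.
  have [k pk] := IHt m G (eq_ind_r (fun z => (z < s.+1)%N) sF sG) G0
                   (leq_trans mn nt) pm.
  exists k.+1; rewrite GE mulrC; apply: PrimeProductMul => //.
  exact: polyC_prime.
have [[G [H [FE sG sH]]]|Firr] := pselect (exists G H,
    [/\ F = G * H, (size G < size F)%N & (size H < size F)%N]).
  have [k pk] : exists k, prime_product k G.
    apply: IHs; first exact: leq_trans sG _.
    by apply: contraNneq F0 => G0; rewrite FE G0 mul0r.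
  have [l pl] : exists l, prime_product l H.
    apply: IHs; first exact: leq_trans sH _.
    by apply: contraNneq F0 => H0; rewrite FE H0 mulr0.
  by exists (k + l)%N; rewrite FE; exact: prime_product_mul.
exists 1%N; apply/prime_product1/poly_prime => //.
  by move=> p pP pF; apply: Fp; exists p.
by move=> G H FE sG sH; apply: Firr; exists G, H.
Qed.

End PolyDivides.

Section Transport.
Variables (A B : idomainType) (phi : {rmorphism A -> B}).
Variable psi : {rmorphism B -> A}.
Hypotheses (phiK : cancel phi psi) (psiK : cancel psi phi).

Lemma prime_elt_iso b : prime_elt b -> prime_elt (psi b).
Proof.
case=> b0 bU bM; split.
- by rewrite -(inj_eq (can_inj psiK)) rmorph0 in b0 *.
- by apply: contra bU => /(rmorph_unit phi); rewrite psiK.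
move=> x y [c xyE]; case: (bM (phi x) (phi y)) => [|[e E]|[e E]].
- by exists (phi c); rewrite -rmorphM xyE rmorphM psiK.
- by left; exists (psi e); rewrite -rmorphM -E phiK.
- by right; exists (psi e); rewrite -rmorphM -E phiK.
Qed.

Lemma factorial_iso : factorial_domain B -> factorial_domain A.
Proof.
move=> Bf a a0; have [|n] := Bf (phi a).
  by rewrite -(inj_eq (can_inj phiK)) rmorph0 in a0 *.
rewrite -{2}[a]phiK; move: (phi a) => b pb; exists n.
elim: pb => [u uU|m p c pP _ IH].
  by apply: PrimeProductUnit; exact: rmorph_unit.
by rewrite rmorphM; apply: PrimeProductMul => //; exact: prime_elt_iso.
Qed.

End Transport.

(** * Polynomials in n + 1 variables as univariate polynomials *)

Section MpolyFactorial.
Variables (K : fieldType) (n : nat).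
Implicit Types p q : {mpoly K[n]}.

(** The inverse of [muni], which singles out the last variable; this isomorphism transports
    factoriality. *)
Definition mpoly_of_poly (F : {poly {mpoly K[n]}}) : {mpoly K[n.+1]} :=
  (map_poly (@mwiden n K) F).['X_ord_max].

Lemma mpoly_of_poly_is_zmod_morphism : zmod_morphism mpoly_of_poly.
Proof. by move=> F G; rewrite /mpoly_of_poly rmorphB hornerD hornerN. Qed.

Lemma mpoly_of_poly_is_monoid_morphism : monoid_morphism mpoly_of_poly.
Proof.
split=> [|F G]; first by rewrite /mpoly_of_poly rmorph1 hornerC.
by rewrite /mpoly_of_poly rmorphM hornerM.
Qed.

HB.instance Definition _ := GRing.isZmodMorphism.Build _ _ mpoly_of_poly
  mpoly_of_poly_is_zmod_morphism.
HB.instance Definition _ := GRing.isMonoidMorphism.Build _ _ mpoly_of_poly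
  mpoly_of_poly_is_monoid_morphism.

Lemma muniX (m : 'X_{1..n.+1}) : muni ('X_[m] : {mpoly K[n.+1]}) =
  'X_[[multinom m (widen_ord (leqnSn n) i) | i < n]] *: 'X^(m ord_max).
Proof. by rewrite muniE msuppX big_seq1 mcoeffX eqxx scale1r. Qed.

Lemma mpoly_of_poly0 : mpoly_of_poly 0 = 0.
Proof. exact: raddf0. Qed.

Lemma mpoly_of_polyD : {morph mpoly_of_poly : F G / F + G}.
Proof. exact: raddfD. Qed.

Lemma mpoly_of_polyM : {morph mpoly_of_poly : F G / F * G}.
Proof. exact: rmorphM. Qed.

Lemma mpoly_of_polyC (p : {mpoly K[n]}) : mpoly_of_poly p%:P = mwiden p.
Proof. by rewrite /mpoly_of_poly map_polyC hornerC. Qed.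

Lemma mpoly_of_polyXn k : mpoly_of_poly 'X^k = 'X_ord_max ^+ k.
Proof. by rewrite /mpoly_of_poly map_polyXn hornerXn. Qed.

Lemma muniK : cancel (@muni n K) mpoly_of_poly.
Proof.
have mono c m : mpoly_of_poly (muni (c *: 'X_[m] : {mpoly K[n.+1]})) =
    c *: 'X_[m].
  rewrite -mul_mpolyC muniM muniC muniX mpoly_of_polyM.
  rewrite mpoly_of_polyC mwidenC -mul_polyC mpoly_of_polyM.
  rewrite mpoly_of_polyC mpoly_of_polyXn mwidenX.
  congr (_ * _); rewrite mpolyXn -mpolyXD; congr 'X_[_].
  apply/mnmP=> i; rewrite mnmDE mulmnE mnm1E.
  have [j ->|->] := unliftP ord_max i; last first.
    by rewrite mnmwiden_ordmax eqxx mul1n.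
  have -> : lift ord_max j = widen_ord (leqnSn n) j.
    by apply/val_inj; exact: lift_max.
  rewrite mnmwiden_widen mnmE -val_eqE /= gtn_eqF ?ltn_ord //.
  by rewrite mul0n addn0.
move=> p; elim/mpolyind: p => [|c m p _ _ IH].
  by rewrite muni0 mpoly_of_poly0.
by rewrite muniD mpoly_of_polyD; exact: congr2 (mono c m) IH.
Qed.

Lemma muni_mwiden (p : {mpoly K[n]}) : muni (mwiden p) = p%:P.
Proof.
elim/mpolyind: p => [|c m p _ _ IH]; first by rewrite mwiden0 muni0.
rewrite mwidenD muniD IH polyCD; congr (_ + _).
rewrite mwidenZ mwidenX muniZ muniX mnmwiden_ordmax expr0 alg_polyC.
rewrite -mul_mpolyC -mul_polyC -polyCM; congr (_ * 'X_[_])%:P.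
by apply/mnmP=> i; rewrite mnmE mnmwiden_widen.
Qed.

Lemma mpoly_of_polyK : cancel mpoly_of_poly (@muni n K).
Proof.
move=> F; rewrite -[F in LHS]coefK poly_def.
rewrite (big_morph _ mpoly_of_polyD mpoly_of_poly0).
rewrite (big_morph _ (@muniD n K) (@muni0 n K)) -[RHS]coefK poly_def.
apply: eq_bigr => i _.
rewrite -mul_polyC mpoly_of_polyM muniM mpoly_of_polyC muni_mwiden.
rewrite mpoly_of_polyXn.
suff -> : muni ('X_ord_max ^+ i : {mpoly K[n.+1]}) = 'X^i by [].
rewrite mpolyXn muniX mulmnE mnm1E eqxx mul1n.
set m := [multinom _ | _ < _]; suff -> : m = 0%MM by rewrite mpolyX0 scale1r.
apply/mnmP=> j; rewrite mnmE mulmnE mnm1E mnm0E -val_eqE /=.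
by rewrite gtn_eqF ?ltn_ord.
Qed.

End MpolyFactorial.

Lemma factorial_field (K : fieldType) : factorial_domain K.
Proof. by move=> a a0; exists 0; apply: PrimeProductUnit; rewrite unitfE. Qed.

Lemma factorial_mpoly (K : fieldType) n : factorial_domain {mpoly K[n]}.
Proof.
elim: n => [|n IH].
  apply: (factorial_iso (phi := mcoeff 0%MM) (psi := @mpolyC 0 K))
    (@factorial_field K).
  - by move=> p /=; rewrite -nvar0_mpolyC.
  - exact: mpolyCK.
exact: (factorial_iso (@muniK K n) (@mpoly_of_polyK K n) (factorial_poly IH)).
Qed.

(** * Divisibility and derivatives *)

Section FactorialConsequences.
Variable A : idomainType.
Implicit Types a b f h p : A.

(** Write [f = p * g]. By induction [h = k * g]; since [p] divides [h] but not [g], it divides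
    [k]. *)
Lemma squarefree_divides n f h : prime_product n f ->
    (forall p, prime_elt p -> ~ divides (p ^+ 2) f) ->
    (forall p, prime_elt p -> divides p f -> divides p h) ->
  divides f h.
Proof.
elim=> [u uU _ _|m p g pP _ IH sq fh].
  by exists (h * u^-1); rewrite divrK.
have [k hE] : divides g h.
  apply: IH => q qP; last by move=> qg; apply: fh => //; exact: divides_mull.
  by move=> qg; apply: (sq q qP); exact: divides_mull.
have : divides p h by apply: fh => //; exists g; rewrite mulrC.
have [_ _ pM] := pP; rewrite hE => /pM[[e ->]|[e gE]].
  by exists e; rewrite mulrA.
by case: (sq p pP); exists e; rewrite gE; ring.
Qed.

(** Each prime of [a] fails to divide some [w i], so it divides [b] and cancels; in the end [a] is a
    unit. *)
Lemma proportional_multiple (I : Type) (s w : I -> A) n a b :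
    prime_product n a ->
    (forall p, prime_elt p -> exists i, ~ divides p (w i)) ->
    (forall i, a * s i = b * w i) ->
  exists h, forall i, s i = h * w i.
Proof.
move=> pa wP; elim: pa b => [u uU b E|m p c pP _ IH b E].
  by exists (u^-1 * b) => i; rewrite -mulrA -E mulKr.
have [i pwi] := wP p pP; case: (pP) => p0 _ pM.
have /pM[[e bE]|//] : divides p (b * w i).
  by exists (c * s i); rewrite -E; ring.
apply: (IH e) => j; apply: (mulfI p0).
by rewrite mulrA E bE; ring.
Qed.

End FactorialConsequences.

(** * Homogeneous components of products *)

Section HomogeneousComponents.
Variables (K : fieldType) (n : nat).
Implicit Types (p q f g : {mpoly K[n]}).

(** The test guards against truncated subtraction: for [k < e] the product has no component of
    degree [k]. *)
Lemma pihomog_mul_homog k e p q : q \is e.-homog ->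
  pihomog mdeg k (p * q) =
    if (e <= k)%N then pihomog mdeg (k - e) p * q else 0.
Proof.
(* [N] also exceeds [k], so that the index [k - e] occurs in the decomposition of [p]. *)
move=> qe; pose N := (maxn (msize p) k.+1).
have pE := pihomog_partitionE (leq_maxl (msize p) k.+1) : p = _.
rewrite {1}pE mulr_suml raddf_sum /=.
have piE (j : 'I_N) : pihomog mdeg k (pihomog mdeg j p * q) =
    if (j + e == k)%N then pihomog mdeg j p * q else 0.
  have jh := dhomogM (pihomogP mdeg j p) qe.
  case: eqP => [jk|/eqP jk]; first by rewrite pihomog_dE // -jk.
  by rewrite (pihomog_ne0 _ jh).
rewrite (eq_bigr _ (fun j _ => piE j)); case: leqP => ek; last first.
  by rewrite big1 // => j _; case: eqP => // jk; lia.
have kN : (k - e < N)%N by rewrite /N leq_max; lia.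
rewrite (bigD1 (Ordinal kN)) //= subnK // eqxx big1 ?addr0 // => j.
by rewrite -val_eqE /= => jk; case: eqP => // jek; case/eqP: jk; lia.
Qed.

(** The components of [g * f] are those of [g] times [f], and [f] cancels. For [k < d] the product
    vanishes, and [g] with it. *)
Lemma homog_quotient d k f g : f != 0 -> f \is d.-homog ->
  g * f \is k.-homog -> g = pihomog mdeg (k - d) g.
Proof.
move=> f0 fd gfk; apply: (mulIf f0); have := pihomog_mul_homog k g fd.
rewrite pihomog_dE //; case: leqP => // kd /eqP; rewrite mulf_eq0 (negPf f0).
by rewrite orbF => /eqP ->; rewrite raddf0.
Qed.

Lemma mcoeff_pihomog k p m :
  (pihomog mdeg k p)@_m = if mdeg m == k then p@_m else 0.
Proof.
rewrite pihomogE (raddf_sum (mcoeff m)) /=.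
under eq_bigr => m' _ do rewrite mcoeffZ mcoeffX.
have [mp|mp] := boolP (m \in msupp p); last first.
  rewrite (memN_msupp_eq0 mp) if_same big_seq_cond big1 // => m' /andP[m'p _].
  by case: eqP m'p => [->|_ _]; rewrite ?(negPf mp) ?mulr0.
rewrite big_mkcond (bigD1_seq m) ?msupp_uniq //= eqxx mulr1 big1 ?addr0 //.
by move=> m' /negPf ->; rewrite mulr0 if_same.
Qed.

Lemma pihomog_mlead_neq0 p : p != 0 -> pihomog mdeg (mdeg (mlead p)) p != 0.
Proof.
move=> p0; apply: contra_neq p0 => E; apply/eqP; rewrite -mleadc_eq0.
have := congr1 (mcoeff (mlead p)) E.
by rewrite mcoeff_pihomog eqxx mcoeff0 => ->.
Qed.

End HomogeneousComponents.

Section Mpoly.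
Variables (K : numFieldType) (n : nat).
Implicit Types (p q f : {mpoly K[n]}) (i : 'I_n).

Lemma msize_mderiv_lt p i : p^`M(i) != 0 -> (msize p^`M(i) < msize p)%N.
Proof.
move=> dp0; rewrite -(mlead_deg dp0).
have := mlead_supp dp0; set m := mlead _.
rewrite mcoeff_msupp mcoeff_mderiv => pm.
have : (m + U_(i))%MM \in msupp p.
  by rewrite mcoeff_msupp; apply: contraNneq pm => ->; rewrite mul0rn.
by move=> /msize_mdeg_lt; rewrite mdegD mdeg1 addn1.
Qed.

(** Characteristic zero enters here: a positive exponent is a nonzero scalar. *)
Lemma mderiv_eq0 p : (forall i, p^`M(i) = 0) -> p = (p@_0)%:MP.
Proof.
move=> dp; apply/mpolyP => m; rewrite mcoeffC.
have [->|m0] := eqVneq m 0%MM; first by rewrite mulr1.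
rewrite mulr0; have [i mi] : exists i, m i != 0%N.
  apply/existsP; apply: contraNT m0; rewrite negb_exists => /forallP m0.
  by apply/eqP/mnmP => i; rewrite mnm0E; apply/eqP; have := m0 i; rewrite negbK.
have mE : m = (m - U_(i) + U_(i))%MM by rewrite submK // lep1mP.
apply/eqP; have := congr1 (mcoeff (m - U_(i))%MM) (dp i).
rewrite mcoeff_mderiv mcoeff0 -mE => /eqP.
by rewrite mulrn_eq0.
Qed.

Lemma mderiv_homog d f i : f \is d.-homog -> f^`M(i) \is d.-1.-homog.
Proof.
move=> /dhomogP fh; apply/dhomogP => m; rewrite mcoeff_msupp mcoeff_mderiv.
move=> fm; have /fh <- : (m + U_(i))%MM \in msupp f.
  by rewrite mcoeff_msupp; apply: contraNneq fm => ->; rewrite mul0rn.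
by rewrite /= mdegD mdeg1 addn1.
Qed.

Lemma euler_identity d f : f \is d.-homog ->
  \sum_(i < n) 'X_i * f^`M(i) = f *+ d.
Proof.
move=> /dhomogP fh; rewrite {2}[f]mpolyE -sumrMnl.
under eq_bigr => i _.
  rewrite {1}[f]mpolyE (raddf_sum (@mderiv n K i)) mulr_sumr /=; over.
rewrite exchange_big /= big_seq [RHS]big_seq; apply: eq_bigr => m /fh /= <-.
rewrite mdegE -sumrMnr; apply: eq_bigr => i _.
rewrite mderivZ mderivX scalerA -scalerAr -mpolyXD.
have [mi|mi] := eqVneq (m i) 0%N.
  by rewrite mi mulr0 scale0r mulr0n.
by rewrite addmC submK ?lep1mP // mulr_natr scalerMnl.
Qed.

(* A prime factor of [f] divides every [f^`M(i)] only if its square divides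
   [f], its own derivatives being of smaller degree. *)
Lemma divides_of_mderiv f h : f != 0 ->
    (forall p, prime_elt p -> ~ divides (p ^+ 2) f) ->
    (forall i, divides f (h * f^`M(i))) ->
  divides f h.
Proof.
move=> f0 sq fh; have [m pf] := factorial_mpoly f0.
apply: (squarefree_divides pf sq) => p pP [q fE].
have [p0 pU pM] := pP.
have pq : ~ divides p q.
  by case=> e qE; apply: (sq p pP); exists e; rewrite fE qE; ring.
(* From [f = q * p], the derivative of [f] is [q] times that of [p] modulo [p], and [p] does not
   divide [q]. *)
have pd i : divides p (h * p^`M(i)).
  have [c] := fh i; rewrite fE mderivM => cE.
  have : divides p (q * (h * p^`M(i))).
    exists (c * q - h * q^`M(i)); rewrite mulrBl -[in RHS]mulrA -cE; ring.
  by case/pM.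
have [[i di]|nd] := pselect (exists i, p^`M(i) != 0).
  case: (pM _ _ (pd i)) => // -[c cE]; have c0 : c != 0.
    by apply: contraNneq di => c0; rewrite cE c0 mul0r.
  have := msize_mderiv_lt di; rewrite cE msizeM //.
  by rewrite (mpolySpred mdeg c0) addSn /= ltnNge leq_addl.
have pC : p = (p@_0)%:MP.
  by apply: mderiv_eq0 => i; apply: contrapT => /eqP di; apply: nd; exists i.
case/negP: pU; apply/andP; split; first exact/eqP.
by rewrite unitfE; apply: contraNneq p0 => pe; rewrite pC pe mpolyC0.
Qed.

End Mpoly.

(** * Free families and ideals *)

(** Linear independence in the quotient of [V] by [Q], expressed without forming the quotient. *)
Definition free_mod (K : fieldType) (V : lmodType K) (Q : set V) (I : finType)
    (b : I -> V) : Prop :=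
  forall c : I -> K, Q (\sum_i c i *: b i) -> forall i, c i = 0.

Definition in_span (K : fieldType) (V : lmodType K) (J : finType) (w : J -> V)
    (p : V) : Prop := exists c : J -> K, p = \sum_j c j *: w j.

Section FreeFamilies.
Variables (K : fieldType) (V : lmodType K).

Lemma in_span0 (J : finType) (w : J -> V) : in_span w 0.
Proof. by exists (fun=> 0); rewrite big1 // => j _; rewrite scale0r. Qed.

Lemma in_spanD (J : finType) (w : J -> V) p q :
  in_span w p -> in_span w q -> in_span w (p + q).
Proof.
move=> [c ->] [e ->]; exists (fun j => c j + e j); rewrite -big_split /=.
by apply: eq_bigr => j _; rewrite scalerDl.
Qed.

Lemma in_spanZ (J : finType) (w : J -> V) k p :
  in_span w p -> in_span w (k *: p).
Proof.
move=> [c ->]; exists (fun j => k * c j); rewrite scaler_sumr.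
by apply: eq_bigr => j _; rewrite scalerA.
Qed.

Lemma in_span_sum (J : finType) (w : J -> V) (I : eqType) (s : seq I)
    (F : I -> V) :
  {in s, forall i, in_span w (F i)} -> in_span w (\sum_(i <- s) F i).
Proof.
move=> sF; rewrite big_seq; elim/big_ind: _ => //; first exact: in_span0.
by move=> p q; exact: in_spanD.
Qed.

Lemma in_span_gen (J : finType) (w : J -> V) j : in_span w (w j).
Proof.
exists (fun i => (i == j)%:R).
rewrite (bigD1 j) //= eqxx scale1r big1 ?addr0 //.
by move=> i /negPf ->; rewrite scale0r.
Qed.

(** With more vectors than generators, the coefficient matrix has a nonzero left kernel, which is a
    linear relation. *)
Lemma free_in_span_leq (I J : finType) (b : I -> V) (w : J -> V) :
  free_mod [set 0] b -> (forall i, in_span w (b i)) -> (#|I| <= #|J|)%N.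
Proof.
move=> bfree /choice[A bA].
pose M : 'M[K]_(#|I|, #|J|) := \matrix_(i, j) A (enum_val i) (enum_val j).
rewrite leqNgt; apply/negP => ltJI.
have : kermx M != 0.
  by rewrite kermx_eq0 /row_free neq_ltn (leq_ltn_trans (rank_leq_col M) ltJI).
case/rowV0Pn => u /sub_kermxP uM; case/negP; apply/eqP/rowP => i; rewrite mxE.
have := bfree (fun i => u 0 (enum_rank i)) _ (enum_val i).
rewrite enum_valK; apply => /=.
under eq_bigr => k _ do rewrite bA scaler_sumr.
rewrite exchange_big /= big1 // => j _.
under eq_bigr => k _ do rewrite scalerA.
rewrite -scaler_suml (reindex (@enum_val I predT)) /=; last first.
  by apply: onW_bij; exact: enum_val_bij.
have := congr1 (fun N : 'rV_#|J| => N 0 (enum_rank j)) uM.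
rewrite !mxE => E; rewrite [X in X *: _](_ : _ = 0) ?scale0r // -[RHS]E.
by apply: eq_bigr => i0 _; rewrite mxE enum_valK enum_rankK.
Qed.

End FreeFamilies.

Section PolyBounds.
Variables (K : fieldType) (n : nat).
Implicit Types p q : {mpoly K[n]}.

(** [msize] is the degree plus one; the shifted bounds add like degrees. *)
Lemma msizeM_leS a b p q : (msize p <= a.+1)%N -> (msize q <= b.+1)%N ->
  (msize (p * q) <= (a + b).+1)%N.
Proof.
move=> pa qb; have [->|p0] := eqVneq p 0; first by rewrite mul0r msize0.
have [->|q0] := eqVneq q 0; first by rewrite mulr0 msize0.
by rewrite msizeM //; move: (msize p) (msize q) pa qb => x y; lia.
Qed.

Lemma msizeX_leS a k p : (msize p <= a.+1)%N ->
  (msize (p ^+ k) <= (k * a).+1)%N.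
Proof.
move=> pa; elim: k => [|k IH]; first by rewrite expr0 msize1.
by rewrite exprS mulSn; exact: msizeM_leS.
Qed.

(** The monomials that occur have all exponents below [M], and there are [M ^ n] monomials in this
    box. *)
Lemma free_msize_leq (I : finType) (b : I -> {mpoly K[n]}) M :
    free_mod [set 0] b -> (forall i, msize (b i) <= M)%N ->
  (#|I| <= M ^ n)%N.
Proof.
move=> bfree bM.
pose mon (e : {ffun 'I_n -> 'I_M}) : 'X_{1..n} :=
  [multinom nat_of_ord (e i) | i < n].
have -> : (M ^ n)%N = #|{ffun 'I_n -> 'I_M}| by rewrite card_ffun !card_ord.
apply: (free_in_span_leq (w := fun e => 'X_[mon e])) bfree _ => i.
rewrite [b i]mpolyE; apply: in_span_sum => m mb; apply: in_spanZ.
have mM k : (m k < M)%N.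
  apply: leq_trans (bM i); apply: leq_ltn_trans (msize_mdeg_lt mb).
  by rewrite mdegE (bigD1 k) //= leq_addr.
have -> : m = mon [ffun k => Ordinal (mM k)].
  by apply/mnmP => k; rewrite mnmE ffunE.
exact: (in_span_gen (fun e => 'X_[mon e])).
Qed.

End PolyBounds.

(** * Ideals and primes disjoint from a multiplicative set *)

Definition ideal_closed (A : comNzRingType) (I : set A) : Prop :=
  I 0 /\ forall a x y, I x -> I y -> I (a * x + y).

Section Ideals.
Variable A : comNzRingType.
Implicit Types (I P : set A) (g h : A).

Lemma ideal_closedM I a x : ideal_closed I -> I x -> I (a * x).
Proof. by move=> [I0 Il] Ix; rewrite -[_ * _]addr0; exact: Il. Qed.

Lemma ideal_closedD I x y : ideal_closed I -> I x -> I y -> I (x + y).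
Proof. by move=> [I0 Il] Ix Iy; rewrite -[x]mul1r; exact: Il. Qed.

Lemma ideal_closedB I x y : ideal_closed I -> I x -> I y -> I (x - y).
Proof. by move=> [I0 Il] Ix Iy; rewrite addrC -mulN1r; exact: Il. Qed.

Lemma prime_idealP P : prime_ideal P <->
  [/\ ideal_closed P, ~ P 1 & forall x y, P (x * y) -> P x \/ P y].
Proof.
split=> [[[P0 P1 Pl] Pp]|[[P0 Pl] P1 Pp]].
  split; first split.
  - by move: P0; rewrite inE.
  - move=> a x y /mem_set Px /mem_set Py; have := Pl a x y Px Py.
    by rewrite inE.
  - by move: P1; rewrite notin_setE.
  - move=> x y /mem_set /Pp /orP[]; rewrite inE; [by left|by right].
split; first split.
- by rewrite inE.
- by rewrite notin_setE.
- by move=> a x y; rewrite !inE; exact: Pl.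
- by move=> x y; rewrite inE => /Pp[|]/mem_set ->; rewrite ?orbT.
Qed.

Lemma ideal_gen2_closed g h : ideal_closed (ideal_gen2 g h).
Proof.
split; first by exists 0, 0; rewrite !mul0r addr0.
move=> a _ _ [u [v ->]] [u' [v' ->]]; exists (a * u + u'), (a * v + v').
by ring.
Qed.

Lemma ideal_gen2l g h : ideal_gen2 g h g.
Proof. by exists 1, 0; rewrite mul1r mul0r addr0. Qed.

Lemma ideal_gen2r g h : ideal_gen2 g h h.
Proof. by exists 0, 1; rewrite mul1r mul0r add0r. Qed.

(** An ideal maximal among those that contain [I] and are disjoint from a multiplicative set is
    prime. *)
Lemma prime_ideal_avoiding I (M : set A) : ideal_closed I -> M 1 ->
    (forall x y, M x -> M y -> M (x * y)) -> (forall x, I x -> ~ M x) ->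
  exists P, [/\ prime_ideal P, I `<=` P & forall x, P x -> ~ M x].
Proof.
move=> [I0 Il] M1 MM IM.
(* Adding [I] makes the empty set good, as Zorn's lemma requires for the empty chain. *)
pose good X := ideal_closed (X `|` I) /\ forall x, (X `|` I) x -> ~ M x.
have [F Fgood Ftot|X [[Xi XM] Xmax]] := @Zorn_bigcup A good.
  have [->|/set0P[X0 FX0]] := eqVneq F set0.
    by rewrite bigcup_set0; split; rewrite set0U.
  have inF x : (\bigcup_(X in F) X `|` I) x -> exists2 X, F X & (X `|` I) x.
    by move=> [[X FX Xx]|Ix]; [exists X => //; left|exists X0 => //; right].
  have Fin X : F X -> X `|` I `<=` \bigcup_(X in F) X `|` I.
    by move=> FX x [Xx|Ix]; [left; exists X|right].
  split; last by move=> x /inF[X FX]; exact: (Fgood X FX).2.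
  split; first by right.
  move=> a x y /inF[X FX Xx] /inF[Y FY Yy].
  have [XY|YX] := Ftot X Y FX FY.
  - apply: (Fin _ FY); apply: (Fgood Y FY).1.2 => //.
    by case: Xx => [/XY|]; [left|right].
  - apply: (Fin _ FX); apply: (Fgood X FX).1.2 => //.
    by case: Yy => [/YX|]; [left|right].
pose P := X `|` I; exists P; split=> //; last by move=> x; right.
have [P0 Pl] := Xi.
apply/prime_idealP; split=> // [/XM/(_ M1)//|x y Pxy].
(* For [z] outside [P], the ideal [P + (z)] is strictly larger, so by maximality it meets [M]. *)
have enl z : ~ P z -> exists p a, P p /\ M (p + a * z).
  move=> Pz; pose Y := [set w | exists p a, P p /\ w = p + a * z].
  have PY : P `<=` Y by move=> p Pp; exists p, 0; rewrite mul0r addr0.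
  have YI : Y `|` I = Y.
    by apply/seteqP; split=> [w [//|Iw]|w]; [apply: PY; right|left].
  apply: contrapT => noM; apply: (Xmax Y).
    split; first by move=> w Xw; apply: PY; left.
    by move=> YX; apply: Pz; left; apply: YX; exists 0, 1; rewrite mul1r add0r.
  split; rewrite YI.
    split; first exact: PY.
    move=> a _ _ [p [b [Pp ->]]] [q [c [Pq ->]]].
    exists (a * p + q), (a * b + c); split; [exact: Pl|ring].
  by move=> w [p [a [Pp ->]]] Mw; apply: noM; exists p, a.
apply: contrapT => /not_orP[/enl[p [a [Pp Mp]]] /enl[q [b [Pq Mq]]]].
apply: (XM _ _ (MM _ _ Mp Mq)).
have -> : (p + a * x) * (q + b * y) =
    (q + b * y) * p + ((a * x) * q + (a * b) * (x * y)) by ring.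
by apply: (Pl) => //; apply: (Pl) => //; apply: (ideal_closedM _ Xi).
Qed.

End Ideals.

(** * Heights of prime ideals *)

Section Height.
Variables (K : fieldType) (n : nat).
Local Notation S := {mpoly K[n]}.

Definition transcendental_mod (P : set S) (t : S) : Prop :=
  forall N, free_mod P (fun i : 'I_N => t ^+ i).

(** View a relation as a polynomial in [s]. Its constant term lies in [Q'], so its coefficients
    vanish; the rest is [s] times a shorter relation, and [s] cancels modulo the prime [Q]. *)
Lemma free_mod_power N (Q Q' : set S) (I : finType) (b : I -> S) s :
    prime_ideal Q -> prime_ideal Q' -> Q `<=` Q' -> Q' s -> ~ Q s ->
    free_mod Q' b ->
  free_mod Q (fun x : 'I_N * I => s ^+ x.1 * b x.2).
Proof.
move=> /prime_idealP[Qi _ Qp] /prime_idealP[Qi' _ _] QQ' Q's Qs bfree.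
have key M (c : nat -> I -> K) :
    Q (\sum_(j < M) s ^+ j * \sum_i c j i *: b i) ->
    forall j, (j < M)%N -> forall i, c j i = 0.
  elim: M c => // M IH c; rewrite big_ord_recl expr0 mul1r => Qc.
  have tailE : \sum_(j < M) s ^+ lift ord0 j * \sum_i c (lift ord0 j) i *: b i =
      s * \sum_(j < M) s ^+ j * \sum_i c j.+1 i *: b i.
    by rewrite mulr_sumr; apply: eq_bigr => j _; rewrite exprS mulrA.
  rewrite tailE in Qc.
  have c0 : forall i, c 0 i = 0.
    apply: bfree; set T := s * _ in Qc; rewrite -[X in Q' X](addrK T).
    apply: ideal_closedB => //; first exact: QQ'.
    by rewrite /T mulrC; exact: ideal_closedM.
  rewrite big1 ?add0r in Qc; last by move=> i _; rewrite c0 scale0r.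
  have [//|Qtail] := Qp _ _ Qc.
  by case=> // j ltjM i; exact: (IH (fun j => c j.+1) Qtail j ltjM i).
move=> c Qc [j i].
(* Coefficients extended by zero to all natural indices, the form required by [key]. *)
pose c' k i' := if insub k is Some k' then c (k', i') else 0.
have c'E (k : 'I_N) i' : c' k i' = c (k, i') by rewrite /c' valK.
rewrite -c'E; apply: (key N) => //.
rewrite (_ : \sum_(_ < N) _ = \sum_x c x *: (s ^+ x.1 * b x.2)) //.
under eq_bigr => k _ do rewrite mulr_sumr.
rewrite pair_bigA /=; apply: eq_bigr => -[k i'] _ /=.
by rewrite c'E scalerAr.
Qed.

(* The transcendence degree of [S / Q i] strictly decreases along the chain. *)
Lemma chain_free_families k (Q : nat -> set S) t :
    (forall i, (i <= k)%N -> prime_ideal (Q i)) ->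
    (forall i, (i < k)%N -> Q i `<` Q i.+1) ->
    transcendental_mod (Q k) t ->
  exists d, forall N, exists (I : finType) (b : I -> S),
    [/\ #|I| = (N ^ k.+1)%N, free_mod (Q 0) b
      & forall i, (msize (b i) <= (N * d).+1)%N].
Proof.
elim: k Q => [|k IH] Q Qp Qlt tfree.
  exists (msize t) => N; exists 'I_N, (fun i : 'I_N => t ^+ i).
  split; [by rewrite card_ord expn1|exact: tfree|move=> i].
  apply: leq_trans (msizeX_leS i (leqnSn (msize t))) _.
  by rewrite ltnS leq_mul2r (ltnW (ltn_ord i)) orbT.
have [d Hd] :=
  IH (fun i => Q i.+1) (fun i => Qp i.+1) (fun i => Qlt i.+1) tfree.
have [Q01 nQ10] := Qlt 0 isT.
have [s Q1s Q0s] : exists2 s, Q 1 s & ~ Q 0 s.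
  apply: contrapT => H; apply: nQ10 => s Q1s; apply: contrapT => Q0s.
  by apply: H; exists s.
exists (msize s + d)%N => N; have [I [b [cI bfree bd]]] := Hd N.
exists ('I_N * I)%type, (fun x : 'I_N * I => s ^+ x.1 * b x.2); split.
- by rewrite card_prod card_ord cI -expnS.
- exact: free_mod_power (Qp 0 isT) (Qp 1 isT) Q01 Q1s Q0s bfree.
move=> [j i] /=; rewrite mulnDr; apply: msizeM_leS => //.
apply: leq_trans (msizeX_leS j (leqnSn (msize s))) _.
by rewrite ltnS leq_mul2r (ltnW (ltn_ord j)) orbT.
Qed.

(** A chain of length [n] would give [N ^ n.+1] independent polynomials of degree at most [N * d],
    but at most [(N * d).+1 ^ n] can be independent. *)
Lemma transcendental_height (P : set S) t :
  transcendental_mod P t -> ~ prime_chain P n.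
Proof.
move=> tP [Q [Qp Qlt QP]]; rewrite -QP in tP.
have [d Hd] := chain_free_families Qp Qlt tP.
(* Chosen so that [(N * d).+1 ^ n <= N ^ n * d.+2 ^ n < N ^ n.+1]. *)
pose N := (d.+2 ^ n).+1; have [I [b [cI bfree bd]]] := Hd N.
have bfree0 : free_mod [set 0] b.
  move=> c /= c0; apply: bfree; rewrite c0.
  by case/prime_idealP: (Qp 0 isT) => -[].
have := free_msize_leq bfree0 bd; rewrite cI leqNgt => /negP[].
apply: leq_ltn_trans (_ : ((N * d.+2) ^ n < _)%N).
  have le2r x y m : (x <= y -> x ^ m <= y ^ m)%N.
    by move=> xy; case: m => // m; rewrite leq_exp2r.
  by apply: le2r; rewrite !mulnS /N; lia.
by rewrite expnMn expnS mulnC ltn_pmul2r ?expn_gt0.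
Qed.

End Height.

Section ChainLength2.
Variable A : idomainType.

Lemma prime_ideal0 : prime_ideal [set 0 : A].
Proof.
apply/prime_idealP; split.
- by split=> // a x y -> ->; rewrite mulr0 addr0.
- by move=> /= /eqP; rewrite oner_eq0.
- by move=> x y /= /eqP; rewrite mulf_eq0 => /orP[]/eqP; [left|right].
Qed.

Lemma prime_ideal_principal (p : A) : prime_elt p -> prime_ideal (divides p).
Proof.
move=> [p0 pU pM]; apply/prime_idealP; split=> //.
- split; first exact: divides0.
  by move=> a x y px py; apply: dividesD => //; exact: divides_mull.
- by move=> /unit_divides1 => pU'; rewrite pU' in pU.
Qed.

(** Some prime factor [p] of [a] lies in [P]; the last hypothesis makes the inclusion of [(p)] in
    [P] strict. *)
Lemma prime_chain2 (P : set A) (a : A) : factorial_domain A -> prime_ideal P ->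
    P a -> a != 0 ->
    (forall p, prime_elt p -> ~ P `<=` divides p) ->
  prime_chain P 2.
Proof.
move=> Af Pp Pa a0 Pnp; have [[P0 Pl] P1 PM] := (prime_idealP P).1 Pp.
have [p pP Pin] : exists2 p, prime_elt p & P p.
  have [n pa] := Af a a0; elim: pa Pa => [u uU Pu|m p b pP _ IH].
    case: P1; rewrite -(mulVr uU); exact: (ideal_closedM _ (conj P0 Pl)).
  by move=> /PM[Pin|/IH //]; exists p.
exists (fun i => if i is j.+1 then if j is 0 then divides p else P
                 else [set 0]).
split=> //.
  case=> [|[|i]] _ //; [exact: prime_ideal0|exact: prime_ideal_principal].
case=> [|[|i]] // _; split.
- by move=> x /= ->; exact: divides0.
- by move=> /(_ p (divides_refl p)) /= p0; case: pP => /eqP.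
- by move=> _ [c ->]; exact: (ideal_closedM _ (conj P0 Pl)).
- exact: Pnp.
Qed.

End ChainLength2.

(** * Primes of small height above two forms *)

Section HomogeneousIdeals.
Variables (K : fieldType) (n : nat).
Local Notation S := {mpoly K[n]}.

Lemma dhomog0_const (p : S) : p \is 0.-homog -> p = (p@_0)%:MP.
Proof.
move=> ph; apply/mpolyP => m; rewrite mcoeffC; have [->|m0] := eqVneq m 0%MM.
  by rewrite mulr1.
by rewrite mulr0; apply: (dhomog_nemf_coeff ph); rewrite /= mdeg_eq0.
Qed.

Lemma homog_coeff0_unit e (p : S) : p \is e.-homog -> p@_0 != 0 ->
  p \is a GRing.unit.
Proof.
move=> ph p0; have e0 : e = 0.
  by apply/esym/eqP; apply: contraNT p0 => e0; apply/eqP;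
     apply: (dhomog_nemf_coeff ph); rewrite /= mdeg0.
rewrite e0 in ph; rewrite (dhomog0_const ph).
by apply: rmorph_unit; rewrite unitfE.
Qed.

(** Compare constant terms: a form with nonzero constant term is a nonzero constant. *)
Lemma homog_gen2_1 e1 e2 (g h : S) : g \is e1.-homog -> h \is e2.-homog ->
  ideal_gen2 g h 1 -> g \is a GRing.unit \/ h \is a GRing.unit.
Proof.
move=> ge he [u [w /(congr1 (mcoeff 0%MM))]].
rewrite mcoeffD !rmorphM /= mcoeff1 eqxx.
have [g0|g0 _] := eqVneq (g@_0) 0.
  have [h0|h0 _] := eqVneq (h@_0) 0.
    by rewrite g0 h0 !mulr0 addr0 => /eqP; rewrite oner_eq0.
  by right; exact: homog_coeff0_unit he h0.
by left; exact: homog_coeff0_unit ge g0.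
Qed.

Lemma ideal_gen2_pihomog e1 e2 (g h p : S) k : g \is e1.-homog ->
  h \is e2.-homog -> ideal_gen2 g h p -> ideal_gen2 g h (pihomog mdeg k p).
Proof.
move=> ge he [u [v ->]]; rewrite raddfD /=.
rewrite (pihomog_mul_homog _ _ ge) (pihomog_mul_homog _ _ he).
apply: ideal_closedD; first exact: ideal_gen2_closed.
  case: leqP => _; last by exists 0, 0; rewrite !mul0r addr0.
  by apply: ideal_closedM; [exact: ideal_gen2_closed|exact: ideal_gen2l].
case: leqP => _; last by exists 0, 0; rewrite !mul0r addr0.
by apply: ideal_closedM; [exact: ideal_gen2_closed|exact: ideal_gen2r].
Qed.

Definition eval_var (i : 'I_n) (q : {poly K}) : S :=
  (map_poly (@mpolyC n K) q).['X_i].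

Lemma eval_varE i q : eval_var i q = \sum_(k < size q) q`_k *: 'X_i ^+ k.
Proof.
rewrite /eval_var (horner_coef_wide _ (size_poly _ _)).
by apply: eq_bigr => k _; rewrite coef_map mul_mpolyC.
Qed.


Lemma eval_varM i q r : eval_var i (q * r) = eval_var i q * eval_var i r.
Proof. by rewrite /eval_var rmorphM hornerM. Qed.

Lemma pihomog_eval_var i q k :
  pihomog mdeg k (eval_var i q) = q`_k *: 'X_i ^+ k.
Proof.
have Xh j : ('X_i ^+ j : S) \is j.-homog.
  by rewrite mpolyXn dhomogX /= mdegMn mdeg1 mul1n.
rewrite eval_varE raddf_sum /=.
have piE (j : 'I_(size q)) : pihomog mdeg k (q`_j *: ('X_i ^+ j : S)) =
    if j == k :> nat then q`_j *: 'X_i ^+ j else 0.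
  rewrite linearZ /=; case: eqP => [<-|/eqP jk]; first by rewrite pihomog_dE.
  by rewrite (pihomog_ne0 jk) // scaler0.
rewrite (eq_bigr _ (fun j _ => piE j)).
have [ltkq|leqk] := ltnP k (size q).
  rewrite (bigD1 (Ordinal ltkq)) //= eqxx big1 ?addr0 // => j.
  by rewrite -val_eqE /= => /negPf ->.
rewrite nth_default // scale0r big1 // => j _.
by case: eqP => // jk; have := ltn_ord j; rewrite jk ltnNge leqk.
Qed.

(** The prime is taken to avoid all nonzero polynomials in ['X_i]. The ideal [(g, h)] avoids them
    too: it is homogeneous, and the top component of such a polynomial is a nonzero multiple of a
    power of ['X_i]. *)
Lemma transcendental_prime (g h : S) e1 e2 i : g \is e1.-homog ->
    h \is e2.-homog -> (forall k, ~ ideal_gen2 g h ('X_i ^+ k)) ->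
  exists P, [/\ prime_ideal P, ideal_gen2 g h `<=` P
    & transcendental_mod P 'X_i].
Proof.
move=> ge he Xgh.
have [|x y [q [q0 ->]] [r [r0 ->]]|x Ix [q [q0 xE]]|P [Pp IP PM]] :=
  @prime_ideal_avoiding S (ideal_gen2 g h)
    [set x | exists q, q != 0 /\ x = eval_var i q] (ideal_gen2_closed g h).
- by exists 1; rewrite oner_neq0 /eval_var rmorph1 hornerC.
- by exists (q * r); rewrite mulf_neq0 // eval_varM.
- have := ideal_gen2_pihomog (size q).-1 ge he Ix.
  rewrite xE pihomog_eval_var -/(lead_coef q) => Iq.
  apply: (Xgh (size q).-1); rewrite -['X_i ^+ _]scale1r.
  rewrite -(mulVf (_ : lead_coef q != 0)) ?lead_coef_eq0 //.
  rewrite -scalerA -mul_mpolyC.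
  by apply: ideal_closedM => //; exact: ideal_gen2_closed.
exists P; split=> // N c Pc.
pose q := \poly_(k < N) (if insub k is Some k' then c k' else 0).
have qE (k : 'I_N) : q`_k = c k by rewrite coef_poly ltn_ord valK.
suff q0 : q = 0 by move=> k; rewrite -qE q0 coef0.
apply: contrapT => /eqP q0; apply: (PM _ Pc); exists q; split=> //.
rewrite /eval_var (horner_coef_wide _ (_ : _ <= N)%N); last first.
  by apply: leq_trans (size_poly _ _) _; exact: size_poly.
by apply: eq_bigr => k _; rewrite coef_map /= qE mul_mpolyC.
Qed.

Section TwoForms.
Variables (g h : S) (e1 e2 k0 : nat).
Hypotheses (ge : g \is e1.+1.-homog) (he : h \is e2.+1.-homog).
Hypothesis Xk0 : forall i, ideal_gen2 g h ('X_i ^+ k0).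

(** A monomial of degree at least [L] has an exponent at least [k0], hence lies in [(g, h)]. *)
Let L := (n * k0).+1.

(** The monomials of degree below [L] will generate [S] as a module over [K[g, h]]; [B] bounds the
    powers of [g] and [h]. *)
Definition form_monomial B (x : 'I_B * 'I_B * 'X_{1..n < L}) : S :=
  g ^+ x.1.1 * h ^+ x.1.2 * 'X_[x.2].

Lemma in_span_form_monomial B (i j : nat) (m : 'X_{1..n}) :
  (i < B)%N -> (j < B)%N -> (mdeg m < L)%N ->
  in_span (@form_monomial B) (g ^+ i * h ^+ j * 'X_[m]).
Proof.
move=> iB jB mL.
have := in_span_gen (@form_monomial B) (Ordinal iB, Ordinal jB, BMultinom mL).
by [].
Qed.

Lemma in_span_form_mulg B p : in_span (@form_monomial B) p ->
  in_span (@form_monomial B.+1) (p * g).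
Proof.
case=> c ->; rewrite mulr_suml -big_enum; apply: in_span_sum => -[[i j] m] _.
rewrite -scalerAl; apply: in_spanZ; rewrite /form_monomial /=.
have -> : g ^+ i * h ^+ j * 'X_[m] * g = g ^+ i.+1 * h ^+ j * 'X_[m].
  by rewrite exprS; ring.
apply: in_span_form_monomial; last exact: bmdeg.
  by rewrite ltnS ltn_ord.
by rewrite ltnS ltnW ?ltn_ord.
Qed.

Lemma in_span_form_mulh B p : in_span (@form_monomial B) p ->
  in_span (@form_monomial B.+1) (p * h).
Proof.
case=> c ->; rewrite mulr_suml -big_enum; apply: in_span_sum => -[[i j] m] _.
rewrite -scalerAl; apply: in_spanZ; rewrite /form_monomial /=.
have -> : g ^+ i * h ^+ j * 'X_[m] * h = g ^+ i * h ^+ j.+1 * 'X_[m].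
  by rewrite exprS; ring.
apply: in_span_form_monomial; last exact: bmdeg.
  by rewrite ltnS ltnW ?ltn_ord.
by rewrite ltnS ltn_ord.
Qed.

(** A monomial of degree at least [L] is [u * g + v * h]. Since [g] and [h] have positive degree,
    taking components replaces [u] and [v] by forms of degree below [k], to which induction
    applies. *)
Lemma homog_in_span B k p : (k < B)%N -> p \is k.-homog ->
  in_span (@form_monomial B) p.
Proof.
elim: B k p => // B IH k p; rewrite ltnS => kB /dhomogP ph.
rewrite [p]mpolyE; apply: in_span_sum => m /ph /= mk; apply: in_spanZ.
have [mL|Lm] := ltnP (mdeg m) L.
  rewrite -[X in in_span _ X]mul1r -[1]mulr1 -{1}(expr0 g) -(expr0 h).
  exact: in_span_form_monomial.
have [i mi] : exists i, (k0 <= m i)%N.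
  apply/existsP; apply: contraTT Lm; rewrite negb_exists -ltnNge => /forallP lt.
  rewrite mdegE ltnS -[n in (n * _)%N]card_ord -sum_nat_const.
  by apply: leq_sum => i _; have := lt i; rewrite -ltnNge => /ltnW.
have Im : ideal_gen2 g h ('X_[m]).
  have mE : m = (m - U_(i) *+ k0 + U_(i) *+ k0)%MM.
    rewrite submK //; apply/mnm_lepP => j; rewrite mulmnE mnm1E.
    by case: eqP => [<-|]; rewrite ?mul1n ?mul0n.
  rewrite mE mpolyXD -mpolyXn.
  by apply: ideal_closedM => //; exact: ideal_gen2_closed.
have [u [v mE]] := Im.
have mh : ('X_[m] : S) \is k.-homog by rewrite dhomogX /= mk.
rewrite -(pihomog_dE mh) mE raddfD /= (pihomog_mul_homog _ _ ge).
rewrite (pihomog_mul_homog _ _ he); apply: in_spanD.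
  case: ltnP => ek; last exact: in_span0.
  by apply/in_span_form_mulg/(IH (k - e1.+1)%N); [lia|exact: pihomogP].
case: ltnP => ek; last exact: in_span0.
by apply/in_span_form_mulh/(IH (k - e2.+1)%N); [lia|exact: pihomogP].
Qed.

(** The [N ^ n] monomials with exponents below [N] would lie in a space whose dimension grows only
    like [N ^ 2]. *)
Lemma two_forms_absurd : (2 < n)%N -> False.
Proof.
move=> n2; pose M := #|{: 'X_{1..n < L}}|.
(* The spanning family for degrees below [n * (2 * N)] has [4 * n ^ 2 * M * N ^ 2] elements, fewer
   than [N ^ 3]. *)
have [N NE] : exists N, N = (4 * n ^ 2 * M).+1 by eexists.
pose mon (e : {ffun 'I_n -> 'I_N}) : 'X_{1..n} :=
  [multinom nat_of_ord (e i) | i < n].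
have mon_inj : injective mon.
  move=> e e' /mnmP E; apply/ffunP => i; apply/val_inj.
  by have := E i; rewrite !mnmE.
have mdeg_mon e : (mdeg (mon e) < n * (2 * N))%N.
  apply: leq_ltn_trans (_ : n * N < _)%N; last by rewrite ltn_pmul2l; lia.
  rewrite mdegE -[n in (n * _)%N]card_ord -sum_nat_const.
  by apply: leq_sum => i _; rewrite mnmE ltnW.
have mfree : free_mod [set 0] (fun e => 'X_[mon e] : S).
  move=> c /= /(congr1 (mcoeff _)) E e; have := E (mon e).
  rewrite mcoeff0 raddf_sum (bigD1 e) //= mcoeffZ mcoeffX eqxx mulr1.
  rewrite big1 ?addr0 //.
  by move=> e' ne; rewrite mcoeffZ mcoeffX inj_eq // (negPf ne) mulr0.
have := free_in_span_leq mfree (fun e => homog_in_span (mdeg_mon e) _).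
have mh e : ('X_[mon e] : S) \is (mdeg (mon e)).-homog by rewrite dhomogX /=.
move=> /(_ mh); rewrite card_ffun !card_prod !card_ord -/M leqNgt => /negP[].
apply: (@leq_trans (N ^ 3)); last by rewrite leq_pexp2l ?NE.
have -> : (n * (2 * N) * (n * (2 * N)) * M = 4 * n ^ 2 * M * N ^ 2)%N by ring.
by rewrite [(N ^ 3)%N]expnS ltn_pmul2r ?expn_gt0 NE.
Qed.

End TwoForms.
(** For three variables this bounds the height of [P] by 2. *)
Lemma codim_two_forms (g h : S) : (2 < n)%N ->
    (exists k, g \is k.-homog) -> (exists k, h \is k.-homog) ->
    ~ ideal_gen2 g h 1 ->
  exists P, [/\ prime_ideal P, ideal_gen2 g h `<=` P & ~ prime_chain P n].
Proof.
move=> n2 [e1 ge] [e2 he] gh1.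
(* A constant in a proper ideal is 0, which is homogeneous of every degree; so both degrees may be
   taken positive. *)
have pos p e : p \is e.-homog -> ideal_gen2 g h p ->
    exists e', p \is e'.+1.-homog.
  case: e => [|e] ph Ip; last by exists e.
  exists 0; suff -> : p = 0 by exact: dhomog0.
  have pC := dhomog0_const ph.
  apply: contrapT => /eqP p0; apply: gh1.
  have p00 : p@_0 != 0 by rewrite -(mpolyC_eq0 n) -pC.
  rewrite -mpolyC1 -(mulVf p00) mpolyCM -pC.
  by apply: ideal_closedM => //; exact: ideal_gen2_closed.
have [{}e1 {}ge] := pos g e1 ge (ideal_gen2l g h).
have [{}e2 {}he] := pos h e2 he (ideal_gen2r g h).
have [i Xi] : exists i, forall k, ~ ideal_gen2 g h ('X_i ^+ k).
  apply: contrapT => H.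
  have /choice[k kP] : forall i, exists k, ideal_gen2 g h ('X_i ^+ k).
    move=> i; apply: contrapT => Hi; apply: H; exists i => k Ik.
    by apply: Hi; exists k.
  apply: (two_forms_absurd (k0 := \max_i k i) ge he _ n2) => i.
  rewrite -(subnK (leq_bigmax i)) exprD.
  by apply: ideal_closedM => //; exact: ideal_gen2_closed.
have [P [Pp IP tP]] := transcendental_prime ge he Xi.
by exists P; split=> //; exact: transcendental_height tP.
Qed.

End HomogeneousIdeals.

(** * Cross products *)

Lemma divr_cancel0 (A : comUnitRingType) (x y : A) : x \is a GRing.unit ->
  - (y / x) * x + y = 0.
Proof. by move=> xU; rewrite mulNr divrK // addNr. Qed.

Section LinearCombinations.
Variables (A : comNzRingType) (V : lmodType A).
Implicit Types (a b c : A) (x y z w : V).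

Lemma combination_sub0 a b (p q t : A) : t = a * p + b * q ->
  - a * p + (- b * q + t) = 0.
Proof. by move=> ->; ring. Qed.

Lemma combination_solve a x z w : - a *: x + z = w -> z = w + a *: x.
Proof. by move=> <-; rewrite scaleNr addrAC addNr add0r. Qed.

Lemma combination_solve2 a b x y z w : - a *: x + (- b *: y + z) = w ->
  z = w + a *: x + b *: y.
Proof. by move=> /combination_solve /combination_solve. Qed.

Lemma combination_invert a b c x y z : b * a = 1 -> z = a *: x + c *: y ->
  x = b *: z + (- (b * c)) *: y.
Proof.
by move=> ba ->; rewrite scalerDr !scalerA ba scale1r scaleNr addrK.
Qed.

End LinearCombinations.

Section CrossProduct.
Variable A : comNzRingType.
Implicit Types a b e w : 'rV[A]_3.

Lemma linear_mulr (a x y z t u : A) : x * z = t -> y * z = u ->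
  (a * x + y) * z = a * t + u.
Proof. by move=> <- <-; rewrite mulrDl mulrA. Qed.

Lemma sum3 (V : nmodType) (F : 'I_3 -> V) : \sum_(i < 3) F i = F 0 + F 1 + F 2.
Proof.
rewrite !big_ord_recl big_ord0 addr0 addrA.
by congr (F _ + F _ + F _); apply/val_inj.
Qed.

Lemma forall3 (P : 'I_3 -> Prop) : P 0 -> P 1 -> P 2 -> forall i, P i.
Proof.
move=> P0 P1 P2 [[|[|[|//]]] i3].
- by rewrite (_ : Ordinal i3 = 0) //; apply/val_inj.
- by rewrite (_ : Ordinal i3 = 1) //; apply/val_inj.
- by rewrite (_ : Ordinal i3 = 2) //; apply/val_inj.
Qed.

(** Indices are taken modulo 3, so that one cyclic formula gives all entries with their signs. *)
Definition cross a b : 'rV[A]_3 :=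
  \row_k (a 0 (k + 1) * b 0 (k + 2) - a 0 (k + 2) * b 0 (k + 1)).

Definition dot a b : A := \sum_(i < 3) a 0 i * b 0 i.

Lemma add3E : ((((0 + 1)%R = 1 :> 'I_3) * ((0 + 2)%R = 2 :> 'I_3)) *
  (((1 + 1)%R = 2 :> 'I_3) * ((1 + 2)%R = 0 :> 'I_3)) *
  (((2 + 1)%R = 0 :> 'I_3) * ((2 + 2)%R = 1 :> 'I_3)))%type.
Proof. by do !split; apply/val_inj. Qed.

Lemma double_cross a e w : cross a (cross e w) = dot a w *: e - dot a e *: w.
Proof.
by apply/rowP; apply: forall3; rewrite !mxE !add3E /dot !sum3; ring.
Qed.

Lemma dotC a b : dot a b = dot b a.
Proof. by apply: eq_bigr => i _; rewrite mulrC. Qed.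

Lemma dot_cross e w : dot (cross e w) w = 0.
Proof. by rewrite /dot sum3 !mxE !add3E; ring. Qed.

Lemma dot_cross_linear e a k b b' : dot e (cross a (k *: b + b')) =
  k * dot e (cross a b) + dot e (cross a b').
Proof. by rewrite /dot !sum3 !mxE !add3E; ring. Qed.

Lemma cross_eq0 a b : cross a b = 0 ->
  forall i j, a 0 i * b 0 j = a 0 j * b 0 i.
Proof.
move=> ab0; have E k : a 0 (k + 1) * b 0 (k + 2) = a 0 (k + 2) * b 0 (k + 1).
  by apply/eqP; rewrite -subr_eq0; have /rowP/(_ k) := ab0; rewrite !mxE => ->.
have := (E 0, E 1, E 2); rewrite !add3E => -[[E0 E1] E2].
by apply: forall3; apply: forall3.
Qed.

(** By [double_cross], the cross product of [w] with [cross a b] vanishes. *)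
Lemma cross_orthogonal a b w : dot a w = 0 -> dot b w = 0 ->
  forall i j, w 0 i * cross a b 0 j = w 0 j * cross a b 0 i.
Proof.
move=> aw bw; apply: cross_eq0.
by rewrite double_cross !(dotC w) aw bw !scale0r subr0.
Qed.

Lemma cross_self a : cross a a = 0.
Proof. by apply/rowP => i; rewrite !mxE mulrC subrr. Qed.

Lemma cross0 a : cross a 0 = 0.
Proof. by apply/rowP => i; rewrite !mxE !mulr0 subrr. Qed.

Lemma dot0 a : dot a 0 = 0.
Proof. by rewrite /dot big1 // => i _; rewrite mxE mulr0. Qed.

Lemma dot_delta a i : dot a (delta_mx 0 i) = a 0 i.
Proof.
rewrite /dot (bigD1 i) //= mxE !eqxx mulr1 big1 ?addr0 // => k.
by rewrite mxE eqxx /= => /negPf ->; rewrite mulr0.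
Qed.

Lemma dotNZ a k b : dot a (- (k *: b)) = - (k * dot a b).
Proof. by rewrite /dot !sum3 !mxE; ring. Qed.

(** Meant for [phi] a projection of the triple product onto one degree and [psi] the induced
    projection on the entries of [b]. *)
Lemma dot_cross_map (phi psi : A -> A) e a b :
    {morph phi : x y / x + y} -> {morph phi : x / - x} ->
    (forall i j l, phi (e 0 i * (a 0 j * b 0 l)) =
       e 0 i * (a 0 j * psi (b 0 l))) ->
  phi (dot e (cross a b)) = dot e (cross a (\row_i psi (b 0 i))).
Proof.
move=> phiD phiN phiE; rewrite /dot !sum3 !mxE !add3E !mulrBr.
by rewrite !phiD !phiN !phiE.
Qed.

Lemma det3_cross (M : 'M[A]_3) :
  \det M = dot (row 0 M) (cross (row 1 M) (row 2 M)).
Proof.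
(* Indexing by naturals identifies the various ordinals produced by the cofactor expansions. *)
have [m mE] : exists m : nat -> nat -> A, forall i j, M i j = m i j.
  by exists (fun i j => M (inord i) (inord j)) => i j; rewrite !inord_val.
rewrite /dot sum3 !mxE !add3E !mE.
rewrite (expand_det_row _ 0) !big_ord_recl big_ord0 /cofactor.
rewrite !(expand_det_row _ 0) !big_ord_recl !big_ord0 /cofactor !det_mx11.
rewrite !mxE !mE /= /bump /=; ring.
Qed.

End CrossProduct.

(** * The map v *)

Section BourbakiIdeal.
Variable R : realType.
Local Notation C := R[i].
Local Notation S := {mpoly C[3]}.
Local Notation S3 := 'rV[{mpoly C[3]}]_3.
Implicit Types (f g h p : S) (r s : S3).

Definition grad f : S3 := \row_i f^`M(i).

Definition variables : S3 := \row_i 'X_i.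

Lemma AR_dot f r : AR f r <-> dot r (grad f) = 0.
Proof.
by rewrite /AR /dot /=; under [in X in _ <-> X]eq_bigr => i _ do rewrite mxE.
Qed.

Lemma AR_closed f a r s : AR f r -> AR f s -> AR f (a *: r + s).
Proof.
rewrite /AR /= => rf sf.
under eq_bigr => i _ do rewrite !mxE mulrDl -mulrA.
by rewrite big_split /= -mulr_sumr rf sf mulr0 addr0.
Qed.

Lemma AR0 f : AR f 0.
Proof. by rewrite /AR /= big1 // => i _; rewrite mxE mul0r. Qed.

Lemma ARZ f a r : AR f r -> AR f (a *: r).
Proof.
by move=> rf; rewrite -[_ *: _]addr0; apply: AR_closed => //; exact: AR0.
Qed.

Lemma DeltaE r s : Delta r s = dot variables (cross r s).
Proof. by rewrite /Delta det3_cross !rowK. Qed.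

Lemma Delta_linear r a s s' :
  Delta r (a *: s + s') = a * Delta r s + Delta r s'.
Proof. by rewrite !DeltaE dot_cross_linear. Qed.

Lemma Delta_self r : Delta r r = 0.
Proof. by rewrite DeltaE cross_self dot0. Qed.

Definition pihomog_row k r : S3 := \row_i pihomog mdeg k (r 0 i).

Lemma pihomog_row_homog k r : syz_homog_deg k (pihomog_row k r).
Proof. by move=> i; rewrite mxE; exact: pihomogP. Qed.

Section Curve.
Variables (d : nat) (f : S).
Hypotheses (d_gt0 : (0 < d)%N) (fh : f \is d.-homog) (fsq : squarefree f).

Let f0 : f != 0. Proof. by case: fsq. Qed.

Lemma prime_sq_ndivides p : prime_elt p -> ~ divides (p ^+ 2) f.
Proof.
move=> [_ pU _] [c fE]; case: fsq => _ /(_ p c); rewrite mulrC => /(_ fE) pU'.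
by rewrite pU' in pU.
Qed.

(** Since [r] and [s] are orthogonal to the gradient, [cross r s] is proportional to it; pairing
    with the variables and Euler's identity give the factor [f *+ d]. *)
Lemma Delta_grad r s i : AR f r -> AR f s ->
  Delta r s * f^`M(i) = (f *+ d) * cross r s 0 i.
Proof.
move=> /AR_dot rf /AR_dot sf.
rewrite DeltaE -(euler_identity fh) /dot !mulr_suml.
apply: eq_bigr => k _; rewrite [variables _ _]mxE -!mulrA; congr (_ * _).
have := cross_orthogonal rf sf i k.
by rewrite [grad f 0 i]mxE [grad f 0 k]mxE mulrC.
Qed.

(** The quotient exists, so [xget] does not return its default: [Delta_grad] supplies the
    divisibilities that [divides_of_mderiv] asks for. *)
Lemma v_mul r s : AR f r -> AR f s -> v f r s * f = Delta r s.
Proof.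
move=> rf sf; apply: (@xgetPex _ 0 [set g | g * f = Delta r s]).
have [|c cE] := @divides_of_mderiv _ _ f (Delta r s) f0 prime_sq_ndivides.
  move=> i; rewrite Delta_grad //; exists (d%:R * cross r s 0 i).
  by rewrite -mulr_natr; ring.
by exists c.
Qed.

Lemma v_unique r s g : AR f r -> AR f s -> g * f = Delta r s -> v f r s = g.
Proof. by move=> rf sf gE; apply: (mulIf f0); rewrite v_mul. Qed.

Lemma v_linear r a s s' : AR f r -> AR f s -> AR f s' ->
  v f r (a *: s + s') = a * v f r s + v f r s'.
Proof.
move=> rf sf sf'; apply: v_unique => //; first exact: AR_closed.
rewrite (Delta_linear r a s s').
exact: (linear_mulr a (v_mul rf sf) (v_mul rf sf')).
Qed.

Lemma v_self r : AR f r -> v f r r = 0.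
Proof. by move=> rf; apply: v_unique => //; rewrite mul0r Delta_self. Qed.

Lemma v0 r : AR f r -> v f r 0 = 0.
Proof.
move=> rf; apply: v_unique => //; first exact: AR0.
by rewrite mul0r DeltaE cross0 dot0.
Qed.

Lemma v_scale r a s : AR f r -> AR f s -> v f r (a *: s) = a * v f r s.
Proof.
move=> rf sf; have E := v_linear a rf sf (AR0 f).
rewrite (v0 rf) in E; rewrite -[a *: s]addr0; exact: etrans E (addr0 _).
Qed.

Lemma Bourbaki_closed r : AR f r -> ideal_closed (Bourbaki f r).
Proof.
move=> rf; split; first by exists 0; [exact: AR0|exact: v0].
move=> a _ _ [s sf <-] [s' sf' <-].
exists (a *: s + s'); first exact: AR_closed.
by rewrite v_linear.
Qed.

Lemma Bourbaki_entry r i : AR f r -> Bourbaki f r (r 0 i).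
Proof.
(* The Koszul syzygy has [Delta] equal to [- d f r_i]; the constant [-1/d] normalizes this to
   [r_i f]. *)
move=> rf; pose c : S := (- (d%:R)^-1 : C)%:MP.
pose s : S3 := c *: cross (delta_mx 0 i) (grad f).
have kf : AR f (cross (delta_mx 0 i) (grad f)).
  by apply/AR_dot; exact: dot_cross.
exists s; first exact: ARZ.
apply: v_unique => //; first exact: ARZ.
have -> : Delta r s = c * Delta r (cross (delta_mx 0 i) (grad f)).
  rewrite /s -[c *: _]addr0 Delta_linear [Delta r 0]DeltaE.
  by rewrite cross0 dot0 addr0.
rewrite DeltaE double_cross ((AR_dot f r).1 rf) scale0r sub0r dot_delta dotNZ.
have -> : dot variables (grad f) = f *+ d.
  by rewrite -(euler_identity fh); apply: eq_bigr => k _; rewrite !mxE.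
have cd : c * d%:R = -1.
  rewrite /c -(mpolyC_nat 3 C) -mpolyCM mulNr mulVf ?pnatr_eq0 -?lt0n //.
  by rewrite mpolyCN mpolyC1.
rewrite -[f *+ d]mulr_natr mulrN [c * _]mulrC -!mulrA [d%:R * c]mulrC cd.
by rewrite !mulrN1 !mulrN opprK.
Qed.

Lemma AR_pihomog k r : AR f r -> AR f (pihomog_row k r).
Proof.
rewrite /AR /= => rf.
(* The derivatives of [f] have degree [d.-1], so this component of the relation sees only the degree
   [k] part of [r]. *)
have := congr1 (pihomog mdeg (k + d.-1)) rf; rewrite raddf_sum raddf0 /= => E.
rewrite -[RHS]E; apply: eq_bigr => i _.
rewrite (pihomog_mul_homog _ _ (mderiv_homog i fh)) leq_addl addnK.
by rewrite mxE.
Qed.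

(** The shift is [d1] from the row [r] plus 1 from the row of variables. *)
Lemma Delta_pihomog d1 k r s : syz_homog_deg d1 r ->
  Delta r (pihomog_row k s) = pihomog mdeg (k + d1.+1) (Delta r s).
Proof.
move=> rh.
have term (i j l : 'I_3) : pihomog mdeg (k + d1.+1) ('X_i * (r 0 j * s 0 l)) =
    'X_i * (r 0 j * pihomog mdeg k (s 0 l)).
  have Xr : ('X_i * r 0 j : S) \is d1.+1.-homog.
    have X1 : ('X_i : S) \is 1.-homog by rewrite dhomogX /= mdeg1.
    exact: (dhomogM X1 (rh j)).
  rewrite mulrA mulrC (pihomog_mul_homog _ _ Xr) leq_addl addnK; ring.
rewrite !DeltaE (dot_cross_map (phi := pihomog mdeg _) (pihomogD _ _)
  (pihomogN _ _) (psi := pihomog mdeg k)) // => i j l.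
by rewrite [variables 0 i]mxE; exact: term.
Qed.

End Curve.
End BourbakiIdeal.

(** * Generators of AR(f) *)

Section Generators.
Variable R : realType.
Local Notation C := R[i].
Local Notation S := {mpoly C[3]}.
Local Notation S3 := 'rV[{mpoly C[3]}]_3.
Implicit Types (f g h : S) (r s x : S3) (t rs : seq S3).

Lemma span0 rs : span rs 0.
Proof. by exists (fun=> 0); rewrite big1 // => i _; rewrite scale0r. Qed.

Lemma span_closed rs a r s : span rs r -> span rs s -> span rs (a *: r + s).
Proof.
move=> [c ->] [e ->]; exists (fun i => a * c i + e i).
rewrite scaler_sumr -big_split /=; apply: eq_bigr => i _.
by rewrite scalerDl scalerA.
Qed.

Lemma span_mem rs r : r \in rs -> span rs r.
Proof.
move=> rrs; exists (fun i => (i == index r rs)%:R).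
have lt : (index r rs < size rs)%N by rewrite index_mem.
rewrite (bigD1 (Ordinal lt)) //= eqxx scale1r nth_index // big1 ?addr0 // => i.
by rewrite -val_eqE /= => /negPf ->; rewrite scale0r.
Qed.

Lemma span_sub rs t : {in rs, forall r, span t r} -> span rs `<=` span t.
Proof.
move=> rst _ [c ->]; elim/big_ind: _; first exact: span0.
  by move=> x y tx ty; rewrite -[x]scale1r; exact: span_closed.
move=> i _; rewrite -[_ *: _]addr0; apply: span_closed; last exact: span0.
by apply: rst; exact: mem_nth.
Qed.

Lemma span_AR f rs : {in rs, forall r, AR f r} -> span rs `<=` AR f.
Proof.
move=> rsf _ [c ->]; elim/big_ind: _; first exact: AR0.
  by move=> x y xf yf; rewrite -[x]scale1r; exact: AR_closed.
by move=> i _; apply/ARZ/rsf; exact: mem_nth.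
Qed.

Lemma AR_span_change f rs t : AR f = span rs -> {in rs, forall r, span t r} ->
  {in t, forall r, AR f r} -> AR f = span t.
Proof.
move=> E rst tf; apply/seteqP; split; last exact: span_AR.
by rewrite E; exact: span_sub.
Qed.

Lemma generators_AR f rs r : AR f = span rs -> r \in rs -> AR f r.
Proof. by move=> -> ; exact: span_mem. Qed.

Lemma span2P r s x : span [:: r; s] x <-> exists a b, x = a *: r + b *: s.
Proof.
split=> [[c ->]|[a [b ->]]].
  by exists (c 0), (c 1); rewrite !big_ord_recl big_ord0 addr0.
apply: span_closed; first by apply: span_mem; rewrite !inE eqxx.
rewrite -[_ *: _]addr0; apply: span_closed; last exact: span0.
by apply: span_mem; rewrite !inE eqxx orbT.
Qed.

Lemma span3P r s u x :
  span [:: r; s; u] x <-> exists a b c, x = a *: r + b *: s + c *: u.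
Proof.
split=> [[c ->]|[a [b [c ->]]]].
  by exists (c 0), (c 1), (c 2); rewrite !big_ord_recl big_ord0 addr0 addrA.
rewrite -addrA; apply: span_closed; first by apply: span_mem; rewrite !inE eqxx.
apply: span_closed; first by apply: span_mem; rewrite !inE eqxx orbT.
rewrite -[_ *: _]addr0; apply: span_closed; last exact: span0.
by apply: span_mem; rewrite !inE eqxx !orbT.
Qed.

(** Minimality is phrased with subsequences, so order could matter; but a subsequence of [t] is a
    permutation of one of [rs], and sizes decide. *)
Lemma minimal_generators_perm f rs t : perm_eq rs t ->
  minimal_generators f rs -> minimal_generators f t.
Proof.
move=> rst [rh rE rmin]; have mem := perm_mem rst; split.
- by move=> r; rewrite -mem; exact: rh.
- apply: (AR_span_change rE) => r; first by rewrite mem; exact: span_mem.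
  by rewrite -mem; exact: generators_AR.
move=> u ut uE; have [z zrs uz] : exists2 z, subseq z rs & perm_eq u z.
  have /count_subseqP ut' : exists2 z, subseq z t & perm_eq u z by exists u.
  by apply/count_subseqP => r; rewrite (permP rst).
have zE : AR f = span z.
  apply: (AR_span_change uE) => r.
    by rewrite (perm_mem uz); exact: span_mem.
  by rewrite -(perm_mem uz); exact: generators_AR.
have := rmin z zrs zE => zrs'.
have [_ /esym] := size_subseq_leqif ut.
by rewrite (perm_size uz) zrs' (perm_size rst) eqxx => /eqP.
Qed.

(** Every proper subsequence is contained in one of the three pairs, and a larger family inside
    [AR f] still generates. *)
Lemma minimal_generators3 f r s u :
    syz_homogeneous r -> syz_homogeneous s -> syz_homogeneous u ->
    AR f = span [:: r; s; u] -> AR f <> span [:: s; u] ->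
    AR f <> span [:: r; u] -> AR f <> span [:: r; s] ->
  minimal_generators f [:: r; s; u].
Proof.
move=> rh sh uh E Nsu Nru Nrs; split=> //.
  by move=> x; rewrite !inE => /or3P[] /eqP ->.
move=> t /subseqP[m + ->]; case: m => [|m0 [|m1 [|m2 [|//]]]] // _ tE.
have big t' : {subset mask [:: m0; m1; m2] [:: r; s; u] <= t'} ->
    {subset t' <= [:: r; s; u]} -> AR f = span t'.
  move=> tt' t'rs; apply: (AR_span_change tE) => x.
    by move=> /tt'; exact: span_mem.
  by move=> /t'rs; exact: generators_AR.
case: m0 big {tE} => big; last first.
  case: Nsu; apply: big => x; last by rewrite !inE => ->; rewrite orbT.
  exact: (@mem_mask _ x [:: m1; m2] [:: s; u]).
case: m1 big => big; last first.
  case: Nru; apply: big => x; last first.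
    by rewrite !inE => /orP[] ->; rewrite ?orbT.
  by case: (m2); rewrite /= !inE // => ->.
case: m2 big => // big.
case: Nrs; apply: big => x; last first.
  by rewrite !inE => /orP[] ->; rewrite ?orbT.
by [].
Qed.

Lemma minimal_generators_neq0 f rs : minimal_generators f rs -> 0 \notin rs.
Proof.
move=> [_ rE rmin]; apply/negP => rs0.
have E : AR f = span (rem 0 rs).
  apply: (AR_span_change rE) => r rrs; last first.
    exact: generators_AR rE (mem_rem rrs).
  have [->|r0] := eqVneq r 0; first exact: span0.
  apply: span_mem; have := perm_mem (perm_to_rem rs0) r.
  by rewrite rrs inE (negPf r0).
have /(congr1 size) := rmin _ (rem_subseq 0 rs) E; rewrite size_rem //.
by case: (rs) rs0 => //= y s _; lia.
Qed.

(** Multiples of elements of degree above [k] have no component of degree [k]. *)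
Lemma homog_combination_vanish k (s : S3) rs (c : nat -> S) :
    syz_homog_deg k s -> s = \sum_(i < size rs) c i *: rs`_i ->
    {in rs, forall r, exists2 e, (k < e)%N & syz_homog_deg e r} ->
  s = 0.
Proof.
move=> sk sE rse; apply/rowP => j; rewrite mxE -(pihomog_dE (sk j)) sE summxE.
rewrite raddf_sum big1 // => i _; rewrite mxE.
have [e ke re] := rse _ (mem_nth 0 (ltn_ord i)).
by rewrite /= (pihomog_mul_homog _ _ (re j)) leqNgt ke.
Qed.

(** Take a generator of least degree: a syzygy of smaller degree is a combination of generators of
    larger degree, hence 0. *)
Lemma minimal_generator_of_minimal_degree f rs : minimal_generators f rs ->
  rs != [::] -> exists2 r, r \in rs & minimal_degree_syzygy f r.
Proof.
move=> rsmin rs0; have [rsh rE _] := rsmin.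
have N0 := minimal_generators_neq0 rsmin.
pose P k := `[< exists2 r, r \in rs & syz_homog_deg k r >].
have exP : exists k, P k.
  have [r rrs] : exists r, r \in rs.
    by case: (rs) rs0 => // r rs' _; exists r; rewrite inE eqxx.
  by have [k rk] := rsh r rrs; exists k; apply/asboolP; exists r.
pose k := ex_minn exP; have [/asboolP[r rrs rk] kmin] :
    P k /\ forall l, P l -> (k <= l)%N by rewrite /k; case: ex_minnP.
exists r => //; exists k; split=> //; first exact: generators_AR rE rrs.
  by apply: contraNneq N0 => <-.
move=> l s; rewrite rE => -[c sE] s0 sl; rewrite leqNgt; apply/negP => lk.
case/eqP: s0; apply: homog_combination_vanish sl sE _ => x xrs.
have [e xe] := rsh x xrs; exists e => //; apply: leq_trans lk _.
by apply: kmin; apply/asboolP; exists x.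
Qed.

End Generators.

(** * Syzygies of minimal degree *)

Section MinimalDegree.
Variable R : realType.
Local Notation C := R[i].
Local Notation S := {mpoly C[3]}.
Local Notation S3 := 'rV[{mpoly C[3]}]_3.
Variables (d : nat) (f : S) (r1 : S3).
Hypotheses (d_gt0 : (0 < d)%N) (fh : f \is d.-homog) (fsq : squarefree f).
Hypothesis r1min : minimal_degree_syzygy f r1.
Implicit Types (g h p : S) (r s : S3).

Let r1f : AR f r1. Proof. by case: r1min => ? []. Qed.

Let r1_neq0 : r1 != 0. Proof. by case: r1min => ? []. Qed.

Lemma nonzero_entry r : r != 0 -> exists i, r 0 i != 0.
Proof.
move=> r0; apply: contrapT => H; case/eqP: r0; apply/rowP => i; rewrite mxE.
by apply: contrapT => /eqP ri; apply: H; exists i.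
Qed.

(* Dividing [r1] by a nonconstant common factor would give a syzygy with a
   nonzero component of smaller degree. *)
Lemma minimal_degree_primitive g : (forall i, divides g (r1 0 i)) ->
  g \is a GRing.unit.
Proof.
move=> /choice[q qE]; have [d1 [_ _ r1h dmin]] := r1min.
have [i ri] := nonzero_entry r1_neq0.
have g0 : g != 0 by apply: contraNneq ri => g0; rewrite qE g0 mulr0.
have qi : q i != 0 by apply: contraNneq ri => qi; rewrite qE qi mul0r.
pose s : S3 := \row_j q j.
have sf : AR f s.
  apply: (mulfI g0); rewrite mulr0 -[RHS]r1f mulr_sumr.
  by apply: eq_bigr => j _; rewrite mxE qE mulrA [g * _]mulrC.
(* The degree [k] component of [s] is a nonzero syzygy, so [d1 <= k]; but [d1] is [k] plus the
   degree of [g]. *)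
pose k := mdeg (mlead (q i)).
have d1k : (d1 <= k)%N.
  apply: (dmin k (pihomog_row k s)); last exact: pihomog_row_homog.
    exact: AR_pihomog fh _ _ sf.
  apply: contraNneq (pihomog_mlead_neq0 qi) => /rowP /(_ i).
  by rewrite !mxE => ->.
have gs : (msize g <= 1)%N.
  have d1E : mdeg (mlead (r1 0 i)) = d1.
    exact: (dhomog_mf (r1h i)) (mlead_supp ri).
  have := mlead_deg ri; rewrite d1E qE msizeM // -(mlead_deg qi) -/k /= => E.
  by have := mpolySpred mdeg g0; move: (msize g) E => m; lia.
have gE := msize1_polyC gs.
by rewrite gE; apply: rmorph_unit; rewrite unitfE -(mpolyC_eq0 3) -gE.
Qed.

Lemma Bourbaki_sub_principal g : Bourbaki f r1 `<=` divides g ->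
  g \is a GRing.unit.
Proof.
move=> Bg; apply: minimal_degree_primitive => i; apply: Bg.
exact: (Bourbaki_entry d_gt0 fh fsq).
Qed.

Lemma v_eq0 s : AR f s -> v f r1 s = 0 -> exists h, s = h *: r1.
Proof.
move=> sf vs0; have f0 : f != 0 by case: fsq.
have D0 : Delta r1 s = 0 by rewrite -(v_mul fh fsq r1f sf) vs0 mul0r.
have fd0 : f *+ d != 0.
  rewrite -scaler_nat mscalerI negb_or f0 andbT.
  by rewrite pnatr_eq0 -lt0n.
have c0 : cross r1 s = 0.
  apply/rowP => i; rewrite [RHS]mxE; apply: (mulfI fd0).
  by rewrite -(Delta_grad fh i r1f sf) D0 mul0r mulr0.
have [i ri] := nonzero_entry r1_neq0.
have [n pa] := factorial_mpoly ri.
(* The proportionality is [r1_i s_j = s_i r1_j] with [r1_i] nonzero; primitivity of [r1] removes the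
   primes of [r1_i]. *)
have [||h hE] := proportional_multiple (s := fun j => s 0 j)
  (w := fun j => r1 0 j) (b := s 0 i) pa.
- move=> p [_ pU _]; apply: contrapT => H; case/negP: pU.
  apply: minimal_degree_primitive => j; apply: contrapT => pj.
  by apply: H; exists j.
- by move=> j; rewrite (cross_eq0 c0) mulrC.
by exists h; apply/rowP => j; rewrite mxE hE.
Qed.

Lemma v_homogeneous s : AR f s -> syz_homogeneous s -> homogeneous (v f r1 s).
Proof.
move=> sf [k sh]; have [d1 [_ _ r1h _]] := r1min.
have f0 : f != 0 by case: fsq.
have sE : pihomog_row k s = s.
  by apply/rowP => i; rewrite mxE pihomog_dE.
have vh : v f r1 s * f \is (k + d1.+1).-homog.
  rewrite (v_mul fh fsq r1f sf) -sE (Delta_pihomog k s r1h).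
  exact: pihomogP.
exists (k + d1.+1 - d)%N; rewrite (homog_quotient f0 fh vh); exact: pihomogP.
Qed.

(** Any preimage may be replaced by its component in the degree matching that of [g]. *)
Lemma homogeneous_preimage g : Bourbaki f r1 g -> homogeneous g ->
  exists s, [/\ AR f s, syz_homogeneous s & v f r1 s = g].
Proof.
move=> [s sf vs] [k gh]; have [d1 [_ _ r1h _]] := r1min.
have gfh : g * f \is (k + d).-homog by exact: dhomogM gh fh.
have gf : g * f = Delta r1 s by rewrite -vs (v_mul fh fsq r1f sf).
have [le|lt] := leqP d1.+1 (k + d).
  pose j := (k + d - d1.+1)%N; have jf := AR_pihomog fh j sf.
  exists (pihomog_row j s); split; first exact: jf.
    by exists j; exact: pihomog_row_homog.
  apply: (v_unique fh fsq r1f jf).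
  by rewrite (Delta_pihomog j s r1h) subnK // -gf pihomog_dE.
(* Here the matching degree would be negative: [Delta r1 s] has no component of degree [k + d], so
   [g] is 0. *)
exists 0; split; [exact: AR0|by exists 0 => i; rewrite mxE dhomog0|].
apply: (v_unique fh fsq r1f (AR0 f)).
rewrite -(pihomog_dE gfh) gf !DeltaE.
rewrite (dot_cross_map (phi := pihomog mdeg _) (pihomogD _ _) (pihomogN _ _)
  (psi := fun=> 0)).
  by congr (dot _ (cross _ _)); apply/rowP => i; rewrite !mxE.
move=> i j l; rewrite [variables R 0 i]mxE.
have X1 : ('X_i : S) \is 1.-homog by rewrite dhomogX /= mdeg1.
rewrite mulrA mulrC (pihomog_mul_homog _ _ (dhomogM X1 (r1h j))) add1n.
by rewrite leqNgt lt !mulr0.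
Qed.

Section TwoMoreSyzygies.
Variables r2 r3 : S3.
Hypotheses (r2f : AR f r2) (r2h : syz_homogeneous r2).
Hypotheses (r3f : AR f r3) (r3h : syz_homogeneous r3).

Lemma generators_of_Bourbaki :
  Bourbaki f r1 = ideal_gen2 (v f r1 r2) (v f r1 r3) ->
  AR f = span [:: r1; r2; r3].
Proof.
move=> BE; apply/seteqP; split; last first.
  by apply: span_AR => r; rewrite !inE => /or3P[] /eqP ->.
move=> s sf; have : Bourbaki f r1 (v f r1 s) by exists s.
rewrite BE => -[a [b vE]].
pose s' := (- a) *: r2 + ((- b) *: r3 + s).
have s3f : AR f ((- b) *: r3 + s) by exact: AR_closed.
have s'f : AR f s' by exact: AR_closed.
have [|h hE] := v_eq0 s'f.
  rewrite (v_linear fh fsq (- a) r1f r2f s3f).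
  rewrite (v_linear fh fsq (- b) r1f r3f sf).
  exact: combination_sub0 vE.
by apply/span3P; exists h, a, b; exact: combination_solve2 hE.
Qed.

Lemma Bourbaki_of_generators : AR f = span [:: r1; r2; r3] ->
  Bourbaki f r1 = ideal_gen2 (v f r1 r2) (v f r1 r3).
Proof.
move=> E; have Bc := Bourbaki_closed fh fsq r1f.
apply/seteqP; split=> [_ [s + <-]|_ [a [b ->]]].
  rewrite E => /span3P[a [b [c ->]]]; exists b, c.
  rewrite -addrA (v_linear fh fsq a r1f r1f); last first.
    by apply: AR_closed => //; exact: ARZ.
  rewrite (v_self fh fsq r1f) mulr0 add0r.
  rewrite (v_linear fh fsq b r1f r2f (ARZ c r3f)).
  by rewrite (v_scale fh fsq c r1f r3f).
apply: (ideal_closedD Bc); apply: (ideal_closedM _ Bc).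
  by exists r2.
by exists r3.
Qed.

End TwoMoreSyzygies.

(** As [v] kills [r1], the Bourbaki ideal is principal, generated by [v f r1 s], which must then be
    a unit. *)
Lemma two_generators_Bourbaki1 s : AR f s -> AR f = span [:: r1; s] ->
  Bourbaki f r1 1.
Proof.
move=> sf E; have Bc := Bourbaki_closed fh fsq r1f.
have vU : v f r1 s \is a GRing.unit.
  apply: Bourbaki_sub_principal => _ [u + <-]; rewrite E => /span2P[a [b ->]].
  rewrite (v_linear fh fsq a r1f r1f (ARZ b sf)).
  rewrite (v_self fh fsq r1f) mulr0 add0r.
  by rewrite (v_scale fh fsq b r1f sf); exists b.
by rewrite -(mulVr vU); apply: (ideal_closedM _ Bc); exists s.
Qed.

(** Subtracting a multiple of [r] from [s] cancels the value of [v] and leaves a multiple of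
    [r1]. *)
Lemma unit_quotient_generates r s : AR f r -> AR f s ->
    v f r1 r \is a GRing.unit -> span [:: r1; r] s.
Proof.
move=> rf sf vU; pose h := v f r1 s / v f r1 r.
have [||a aE] := @v_eq0 ((- h) *: r + s); first exact: AR_closed.
  by rewrite (v_linear fh fsq (- h) r1f rf sf); exact: divr_cancel0.
by apply/span2P; exists a, h; exact: combination_solve aE.
Qed.

(** In a combination of degree [d1], the coefficient of a nonzero [s] of degree [k >= d1] is
    constant if [k = d1] and zero otherwise. *)
Lemma minimal_degree_coefficient s a k d1 :
    syz_homog_deg d1 r1 -> (s != 0 -> (d1 <= k)%N) ->
  exists c : C, (if (k <= d1)%N then pihomog mdeg (d1 - k) a else 0) *: s =
    c%:MP *: s.
Proof.
move=> r1h d1k; have [->|s0] := eqVneq s 0; first by exists 0; rewrite !scaler0.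
case: leqP => kd; last by exists 0; rewrite mpolyC0.
have -> : (d1 - k = 0)%N by have := d1k s0; lia.
by exists ((pihomog mdeg 0 a)@_0); rewrite -dhomog0_const //; exact: pihomogP.
Qed.

(** By minimality of its degree, [r1] is a combination of [r] and [s] with constant coefficients,
    not both zero; solve for a term with nonzero coefficient. *)
Lemma exchange r s : AR f r -> syz_homogeneous r -> AR f s ->
    syz_homogeneous s -> span [:: r; s] r1 ->
  span [:: r1; s] r \/ span [:: r1; r] s.
Proof.
move=> rf [k rh] sf [l sh] /span2P[a [b r1E]].
have [d1 [_ _ r1h dmin]] := r1min.
have [c cE] := minimal_degree_coefficient (s := r) a r1h
  (fun nz => dmin k r rf nz rh).
have [e eE] := minimal_degree_coefficient (s := s) b r1h
  (fun nz => dmin l s sf nz sh).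
have {cE eE}r1E : r1 = c%:MP *: r + e%:MP *: s.
  apply: etrans (congr2 +%R cE eE); apply/rowP => i.
  have r1i : r1 0 i = pihomog mdeg d1 (a * r 0 i + b * s 0 i).
    by rewrite -[LHS](pihomog_dE (r1h i)) {1}r1E !mxE.
  rewrite r1i pihomogD (pihomog_mul_homog d1 a (rh i)).
  rewrite (pihomog_mul_homog d1 b (sh i)) !mxE.
  have if_mul (q : bool) (x y : S) :
      (if q then x * y else 0) = (if q then x else 0) * y.
    by case: q => //; rewrite mul0r.
  exact: congr2 (if_mul _ _ _) (if_mul _ _ _).
have [c0|c0] := eqVneq c 0; last first.
  left; apply/span2P; exists (c^-1)%:MP, (- ((c^-1)%:MP * e%:MP)).
  by apply: combination_invert r1E; rewrite -mpolyCM mulVf.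
have [e0|e0] := eqVneq e 0.
  by case/eqP: r1_neq0; rewrite r1E c0 e0 mpolyC0 !scale0r addr0.
right; apply/span2P; exists (e^-1)%:MP, (- ((e^-1)%:MP * c%:MP)).
by rewrite addrC in r1E; apply: combination_invert r1E; rewrite -mpolyCM mulVf.
Qed.

(** Properness carries minimality. If the ideal contains 1, then [v] is a unit on [r2] or [r3] and
    the other is redundant. Conversely, generation by [r1] and one more syzygy puts 1 in the ideal,
    and [exchange] reduces generation by [r2], [r3] to that case. *)
Lemma minimal_generators_Bourbaki r2 r3 :
    AR f r2 -> syz_homogeneous r2 -> AR f r3 -> syz_homogeneous r3 ->
  minimal_generators f [:: r1; r2; r3] <->
  ~ Bourbaki f r1 1 /\ Bourbaki f r1 = ideal_gen2 (v f r1 r2) (v f r1 r3).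
Proof.
move=> r2f r2h r3f r3h; split.
  move=> [_ E rmin]; have BE := Bourbaki_of_generators r2f r3f E; split=> //.
  have [k2 v2h] := v_homogeneous r2f r2h.
  have [k3 v3h] := v_homogeneous r3f r3h.
  rewrite BE => /(homog_gen2_1 v2h v3h)[] vU.
    have E2 : AR f = span [:: r1; r2].
      apply: (AR_span_change E) => r; rewrite !inE; last by case/orP => /eqP ->.
      case/or3P => /eqP ->; [| |exact: unit_quotient_generates];
      by apply: span_mem; rewrite !inE eqxx ?orbT.
    by have := congr1 size (rmin _ (prefix_subseq [:: r1; r2] [:: r3]) E2).
  have E3 : AR f = span [:: r1; r3].
    apply: (AR_span_change E) => r; rewrite !inE; last by case/orP => /eqP ->.
    case/or3P => /eqP ->; [|exact: unit_quotient_generates|];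
    by apply: span_mem; rewrite !inE eqxx ?orbT.
  have sub : subseq [:: r1; r3] [:: r1; r2; r3].
    by apply/subseqP; exists [:: true; false; true].
  by have := congr1 size (rmin _ sub E3).
move=> [B1 BE]; have E := generators_of_Bourbaki r2f r3f BE.
have r1h : syz_homogeneous r1 by case: r1min => k [_ _ rh _]; exists k.
have N3 : AR f <> span [:: r1; r3] by move/(two_generators_Bourbaki1 r3f).
have N2 : AR f <> span [:: r1; r2] by move/(two_generators_Bourbaki1 r2f).
apply: (minimal_generators3 r1h r2h r3h E _ N3 N2) => E23.
have r1s : span [:: r2; r3] r1 by rewrite -E23.
case: (exchange r2f r2h r3f r3h r1s) => sp.
  apply: N3; apply: (AR_span_change E) => r; rewrite !inE; last first.
    by case/orP => /eqP ->.
  by case/or3P => /eqP ->; [|exact: sp|]; apply: span_mem;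
     rewrite !inE eqxx ?orbT.
apply: N2; apply: (AR_span_change E) => r; rewrite !inE; last first.
  by case/orP => /eqP ->.
by case/or3P => /eqP ->; [| |exact: sp]; apply: span_mem;
   rewrite !inE eqxx ?orbT.
Qed.

(** [prime_chain2] bounds the height of every prime from below, [codim_two_forms] that of one prime
    from above. *)
Lemma codim_Bourbaki g h : homogeneous g -> homogeneous h ->
    ~ Bourbaki f r1 1 -> Bourbaki f r1 = ideal_gen2 g h ->
  codim (Bourbaki f r1) 2.
Proof.
move=> gh hh B1 BE.
have chain P : prime_ideal P -> Bourbaki f r1 `<=` P -> prime_chain P 2.
  move=> Pp BP; have [i ri] := nonzero_entry r1_neq0.
  apply: (prime_chain2 (@factorial_mpoly _ 3) Pp _ ri).
    by apply: BP; exact: (Bourbaki_entry d_gt0 fh fsq).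
  move=> p [_ /negP pU _] Pdp; apply: pU; apply: Bourbaki_sub_principal.
  by move=> x /BP /Pdp.
have gh1 : ~ ideal_gen2 g h 1 by rewrite -BE.
have [P [Pp BP P3]] := codim_two_forms (isT : (2 < 3)%N) gh hh gh1.
rewrite -BE in BP; split; last exact: chain.
by exists P; split; [exact: Pp|exact: BP|split; [exact: chain|exact: P3]].
Qed.

End MinimalDegree.

Theorem proposition3p1 (R : realType) (d : nat) (f : {mpoly R[i][3]})
    (hd : (3 <= d)%N) (hf : f \is d.-homog) (hred : squarefree f) :
  (syzygy_curve 3 f <->
     exists r1, minimal_degree_syzygy f r1 /\
                complete_intersection (Bourbaki f r1))
  /\
  (forall r1 r2 r3 : 'rV[{mpoly R[i][3]}]_3,
     minimal_degree_syzygy f r1 ->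
     AR f r2 -> syz_homogeneous r2 ->
     AR f r3 -> syz_homogeneous r3 ->
     (minimal_generators f [:: r1; r2; r3] <->
      ~ Bourbaki f r1 1 /\
      Bourbaki f r1 = ideal_gen2 (v f r1 r2) (v f r1 r3))).
Proof.
have d_gt0 : (0 < d)%N by apply: leq_trans hd.
split; last first.
  by move=> r1 r2 r3 r1min; exact: (minimal_generators_Bourbaki d_gt0 hf hred).
split=> [[rs [rs3 rsmin]]|[r1 [r1min [B1 _ [g [h [gh hh BE]]]]]]].
  (* A generator of least degree serves as [r1] and is moved to the front of the list. *)
  have [|r1 r1rs r1min] := minimal_generator_of_minimal_degree rsmin.
    by rewrite -size_eq0 rs3.
  have prs := perm_to_rem r1rs.
  have : size (rem r1 rs) = 2 by rewrite size_rem // rs3.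
  case E : (rem r1 rs) => [|r2 [|r3 []]] // _; rewrite {}E in prs.
  have min3 := minimal_generators_perm prs rsmin.
  have [rh rE _] := min3.
  have r2in : r2 \in [:: r1; r2; r3] by rewrite !inE eqxx orbT.
  have r3in : r3 \in [:: r1; r2; r3] by rewrite !inE eqxx !orbT.
  have [r2f r3f] := (generators_AR rE r2in, generators_AR rE r3in).
  have [r2h r3h] := (rh _ r2in, rh _ r3in).
  have [B1 BE] := (minimal_generators_Bourbaki d_gt0 hf hred r1min r2f r2h r3f
    r3h).1 min3.
  have v2h := v_homogeneous hf hred r1min r2f r2h.
  have v3h := v_homogeneous hf hred r1min r3f r3h.
  exists r1; split=> //; split=> //; last first.
    by exists (v f r1 r2), (v f r1 r3).
  exact: (codim_Bourbaki d_gt0 hf hred r1min v2h v3h).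
have Bg : Bourbaki f r1 g by rewrite BE; exact: ideal_gen2l.
have Bh : Bourbaki f r1 h by rewrite BE; exact: ideal_gen2r.
have [r2 [r2f r2h v2]] := homogeneous_preimage hf hred r1min Bg gh.
have [r3 [r3f r3h v3]] := homogeneous_preimage hf hred r1min Bh hh.
exists [:: r1; r2; r3]; split=> //.
apply/(minimal_generators_Bourbaki d_gt0 hf hred r1min r2f r2h r3f r3h).
by rewrite v2 v3.
Qed.
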